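(* Let $\overline{\mathfrak D^0}$ and $\overline{\mathfrak D^1}$ be the sets of leasts to $0$ and leasts to $1$, respectively, as defined in the context. Then, as $s\to 1^+$, $$\sum_{d\in\overline{\mathfrak D^0}}\frac1{d^s}\approx\zeta(s),\qquad \sum_{d\in\overline{\mathfrak D^1}}\frac1{d^s}\approx\sum_{\substack{d\ge 1,\ d\equiv1\ (\mathrm{mod}\ 4)\\ d\text{ non-square}}}\frac1{d^s},$$ where ''$\approx$'' means that the difference of the two sides is bounded as $s\to1^+$.
   Context: $\zeta$ is the Riemann zeta function. For a positive non-square integer $d$, $\omega_d=\frac{1+\sqrt d}2$ if $d\equiv1\pmod 4$ and $\omega_d=\sqrt d$ otherwise. For a quadratic irrational $\alpha$ with eventually periodic simple continued fraction, $l(\alpha)$ denotes its minimal period. Let $\mathfrak I$ be the set of pairs $(y,x)$ of integers with $y>0$, $0\le x<y$ and $x^2\equiv1\pmod y$ or $x^2\equiv-1\pmod y$. For $(y,x)\in\mathfrak I$, $\mathfrak D^0(y,x)$ is the set of all positive non-square integers $d$ of one of the following forms: - (case 1) if $x^2\equiv-1\pmod y$: $d=a_0^2+\frac{2x}{y}a_0+\frac{x^2+1}{y^2}$, where $a_0$ runs over the positive integers with $2a_0\equiv x\frac{1+x^2}{y}\pmod y$; - (case 2) if $x^2\equiv1\pmod y$: $d=a_0^2+\frac{2x}{y}a_0+\frac{x^2-1}{y^2}$, where $a_0$ runs over the positive integers with $2a_0\equiv x\frac{1-x^2}{y}\pmod y$. Similarly $\mathfrak D^1(y,x)$ is the set of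 all positive non-square integers $d$ of one of the following forms: - (case 3) if $x^2\equiv-1\pmod y$: $d=(2a_0-1)^2+\frac{4x}{y}(2a_0-1)+\frac{4x^2+4}{y^2}$, where $a_0$ runs over the positive integers with $2a_0\equiv1+x\frac{1+x^2}{y}\pmod y$; - (case 4) if $x^2\equiv1\pmod y$: $d=(2a_0-1)^2+\frac{4x}{y}(2a_0-1)+\frac{4x^2-4}{y^2}$, where $a_0$ runs over the positive integers with $2a_0\equiv1+x\frac{1-x^2}{y}\pmod y$. (These are integers, those in $\mathfrak D^1(y,x)$ being $\equiv1\pmod4$. Each set may be empty. Only for $y\le2$ can $x$ satisfy both congruences; then all elements from either case are included.) For $(y,x)\in\mathfrak I$ write $x/y=[0,a_1,\dots,a_n]$ with $\{a_1,\dots,a_n\}$ a symmetric (palindromic) sequence of positive integers, where $n$ is even in cases 1 and 3 and odd in cases 2 and 4 (for $(y,x)=(1,0)$ take $n=0$). Let $\overline{\mathfrak D^i}(y,x)$ be $\mathfrak D^i(y,x)$ with its least element removed if the period of that least element $d$ (meaning $l(\sqrt d)$ for $i=0$ and $l(\omega_d)$ for $i=1$) is less than $n+1$; otherwise $\overline{\mathfrak D^i}(y,x)=\mathfrak D^i(y,x)$. A positive non-square integer $d$ is called a least to $i$ ($i=0,1$) if $d$ is the smallest element of $\overline{\mathfrak D^i}(y,x)$ for some $(y,x)\in\mathfrak I$. $\overline{\mathfrak D^i}$ is the set of all leasts to $i$. *)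

(* Defs.v *)
From mathcomp Require Import all_boot all_order all_algebra.
From mathcomp Require Import all_classical all_reals all_analysis.
Import Order.TTheory GRing.Theory Num.Theory numFieldNormedType.Exports.

Set Implicit Arguments.
Unset Strict Implicit.
Unset Printing Implicit Defensive.

Local Open Scope classical_set_scope.
Local Open Scope ring_scope.

Definition nonsquare (d : nat) : Prop := ~ exists m : nat, d = (m ^ 2)%N.

Definition cf_step {R : realType} (u : R) : R := (u - (Num.floor u)%:~R)^-1.

Definition cf_quotient {R : realType} (u : R) (k : nat) : int :=
  Num.floor (iter k cf_step u).

Definition cf_eventual_period {R : realType} (u : R) (p : nat) : Prop :=
  (0 < p)%N /\ exists N : nat, forall k : nat, (N <= k)%N ->
    cf_quotient u (k + p)%N = cf_quotient u k.

Definition is_least (A : set nat) (d : nat) : Prop :=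
  A d /\ forall e : nat, A e -> (d <= e)%N.

(* The value is 0 when the expansion of u is not eventually periodic (u is then
   not a quadratic irrational). *)
Definition cf_period {R : realType} (u : R) : nat :=
  xget 0%N (is_least (cf_eventual_period u)).

Definition sqrt_nat (R : realType) (d : nat) : R := Num.sqrt d%:R.

Definition omega (R : realType) (d : nat) : R :=
  if d == 1 %[mod 4] then (1 + Num.sqrt d%:R) / 2 else Num.sqrt d%:R.

(* The two congruences x ^ 2 = -1 and x ^ 2 = 1 modulo y. *)
Variant residue := MinusOne | PlusOne.

Definition square_residue (r : residue) (y x : nat) : Prop :=
  match r with
  | MinusOne => (x%:Z ^+ 2 = -1 %[mod y%:Z])%Z
  | PlusOne => (x%:Z ^+ 2 = 1 %[mod y%:Z])%Z
  end.

Definition frakI : set (nat * nat) :=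
  [set yx | let: (y, x) := yx in
     [/\ (0 < y)%N, (x < y)%N &
         square_residue MinusOne y x \/ square_residue PlusOne y x]].

(* The integer divisions below are exact when the corresponding congruence
   for x ^ 2 holds. *)
Definition D0_case (r : residue) (y x : nat) : set nat :=
  [set d | [/\ (0 < d)%N, nonsquare d, square_residue r y x &
    exists a0 : nat, (0 < a0)%N /\
    match r with
    | MinusOne =>
        (2 * a0%:Z = x%:Z * ((1 + x%:Z ^+ 2) %/ y%:Z)%Z %[mod y%:Z])%Z /\
        d%:R = a0%:R ^+ 2 + 2 * x%:R / y%:R * a0%:R
               + (x%:R ^+ 2 + 1) / y%:R ^+ 2 :> rat
    | PlusOne =>
        (2 * a0%:Z = x%:Z * ((1 - x%:Z ^+ 2) %/ y%:Z)%Z %[mod y%:Z])%Z /\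
        d%:R = a0%:R ^+ 2 + 2 * x%:R / y%:R * a0%:R
               + (x%:R ^+ 2 - 1) / y%:R ^+ 2 :> rat
    end]].

Definition D1_case (r : residue) (y x : nat) : set nat :=
  [set d | [/\ (0 < d)%N, nonsquare d, square_residue r y x &
    exists a0 : nat, (0 < a0)%N /\
    match r with
    | MinusOne =>
        (2 * a0%:Z = 1 + x%:Z * ((1 + x%:Z ^+ 2) %/ y%:Z)%Z %[mod y%:Z])%Z /\
        d%:R = (2 * a0%:R - 1) ^+ 2 + 4 * x%:R / y%:R * (2 * a0%:R - 1)
               + (4 * x%:R ^+ 2 + 4) / y%:R ^+ 2 :> rat
    | PlusOne =>
        (2 * a0%:Z = 1 + x%:Z * ((1 - x%:Z ^+ 2) %/ y%:Z)%Z %[mod y%:Z])%Z /\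
        d%:R = (2 * a0%:R - 1) ^+ 2 + 4 * x%:R / y%:R * (2 * a0%:R - 1)
               + (4 * x%:R ^+ 2 - 4) / y%:R ^+ 2 :> rat
    end]].

(* cf_eval [:: a_1; ...; a_n] is [0, a_1, ..., a_n]. *)
Fixpoint cf_eval (a : seq nat) : rat :=
  if a is b :: a' then (b%:R + cf_eval a')^-1 else 0.

(* n is the length of the symmetric expansion of x / y whose parity goes with
   the congruence r; for (y, x) = (2, 1) it depends on r. *)
Definition symmetric_length (r : residue) (y x n : nat) : Prop :=
  if (y, x) == (1%N, 0%N) then n = 0%N else
  exists a : seq nat,
    [/\ size a = n, all (ltn 0) a, rev a = a,
        cf_eval a = x%:R / y%:R &
        odd n = if r is PlusOne then true else false].

(* Dc gives the elements of D(y, x) arising from each congruence, and alpha d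
   is the irrational whose period is compared with n + 1. *)
Section Leasts.
Variables (R : realType) (Dc : residue -> nat -> nat -> set nat).
Variable alpha : nat -> R.

Definition D_all (y x : nat) : set nat :=
  Dc MinusOne y x `|` Dc PlusOne y x.

Definition removed (y x d : nat) : Prop :=
  is_least (D_all y x) d /\
  exists (r : residue) (n : nat),
    [/\ Dc r y x d, symmetric_length r y x n & (cf_period (alpha d) < n.+1)%N].

Definition D_bar (y x : nat) : set nat :=
  [set d | D_all y x d /\ ~ removed y x d].

Definition leasts : set nat :=
  [set d | exists y x : nat, frakI (y, x) /\ is_least (D_bar y x) d].
End Leasts.

Definition leasts0 (R : realType) : set nat := leasts D0_case (@sqrt_nat R).
Definition leasts1 (R : realType) : set nat := leasts D1_case (@omega R).

Local Open Scope ereal_scope.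

Definition zeta {R : realType} (s : R) : \bar R :=
  \sum_(1 <= n <oo) ((n%:R `^ s)^-1)%:E.

Definition dirichlet_sum {R : realType} (A : set nat) (s : R) : \bar R :=
  \esum_(d in A) ((d%:R `^ s)^-1)%:E.

(* Since +oo - +oo = -oo in \bar R, the bound forces both sides to be finite. *)
Definition bounded_difference {R : realType} (f g : R -> \bar R) : Prop :=
  exists M : R, \forall s \near (1%R : R)^'+, `|f s - g s| <= M%:E.

(* Main.v *)
Require Import Defs.
From mathcomp Require Import all_boot all_order all_algebra.
From mathcomp Require Import all_classical all_reals all_analysis.
From mathcomp Require Import ring lra zify.
Import Order.TTheory GRing.Theory Num.Theory numFieldNormedType.Exports.

Set Implicit Arguments.
Unset Strict Implicit.
Unset Printing Implicit Defensive.

(** Leaving out terms changes a Dirichlet series by a bounded amount near s = 1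
    as soon as the sum of 1 / d over the omitted d converges. So it is enough
    that the nonsquare d that are not least form a thin set in this sense; the
    squares, which also occur in the zeta function, do.

    Let alpha be sqrt d or omega_d, the positive root of X^2 - c X - m with
    (c, m) = (0, d) or c = 1, d = 4 m + 1, and call P^2 - c P Q - m Q^2 the norm
    of (P, Q). The set D(y, x) collects the d whose order has a unit of norm
    1 or -1 with coordinates (a y + x, y), a being the parameter written a_0 in
    its definition (D0_caseP, D1_caseP). Every nonsquare d has such units: the
    convergents of alpha have bounded norms, so two of them have the same norm
    N and are congruent modulo N, and their quotient is a unit (pell_exists).
    Take the unit with the smallest y > 0, and the corresponding pair (y, x).

    The aim is the bound y <= 2 a for each d that is not least; let y > 2. This d
    is not the element removed from D(y, x): if x / y = [0, a_1, ...,
    a_n] is symmetric then alpha = [a, a_1, ..., a_n, alpha + a - c], so n + 1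
    is a period, and a shorter one would produce a unit with a smaller second
    coordinate (cf_period_gt). Hence if d is not least, D(y, x) contains a
    smaller element, with the same x and a smaller parameter a'. Both parameters
    satisfy the same congruence, so y divides 2 (a - a') and y <= 2 a
    (unit_param_gap, not_least_param).

    Such a d is determined by the sign of the norm, by (y, x) and by the
    quotient k >= 1 of 2 a by y, and d is at least (k y)^2 / 16. The sum of 1 / d
    is therefore at most a constant times the sum over y of 1 / y^2 times the number of square
    roots of 1 and -1 modulo y. Two such square roots at distance h satisfy
    y | h^2 (h^2 -+ 4), so apart from h = 2 they are at least about y^(1/4)
    apart (sqr_mod_gap); there are O(y^(3/4)) of them, and the sum of y^(-5/4)
    converges (small_param_summable). *)

Local Open Scope ring_scope.

(** * Products of continued fraction matrices *)

Definition quotient_mx (a : int) : 'M[int]_2 :=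
  \matrix_(i, j) (if i == 0 then (if j == 0 then a else 1) else (j == 0)%:R).

Definition cf_mx (l : seq int) : 'M[int]_2 :=
  foldr (fun a A => quotient_mx a *m A) 1%:M l.

Lemma mulmx2E (S : pzSemiRingType) (A B : 'M[S]_2) i j :
  (A *m B) i j = A i 0 * B 0 j + A i 1 * B 1 j.
Proof.
rewrite mxE big_ord_recl big_ord1.
by congr (_ + A i _ * B _ j); apply: val_inj.
Qed.

Lemma det2E (S : comPzRingType) (A : 'M[S]_2) :
  \det A = A 0 0 * A 1 1 - A 0 1 * A 1 0.
Proof.
rewrite (expand_det_row _ 0) big_ord_recl big_ord1 /cofactor !det_mx11 !mxE.
rewrite /= expr0 expr1 mul1r mulN1r mulrN.
by congr (_ * A _ _ - A _ _ * A _ _); apply: val_inj.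
Qed.

Lemma cf_mx_cat l1 l2 : cf_mx (l1 ++ l2) = cf_mx l1 *m cf_mx l2.
Proof. by elim: l1 => [|a l1 IH] /=; rewrite ?mul1mx // IH mulmxA. Qed.

Lemma cf_mx_rcons l a : cf_mx (rcons l a) = cf_mx l *m quotient_mx a.
Proof. by rewrite -cats1 cf_mx_cat /= mulmx1. Qed.

Lemma cf_mx_cons l a : cf_mx (a :: l) = quotient_mx a *m cf_mx l.
Proof. by []. Qed.

Lemma cf_mx_rev l : cf_mx (rev l) = (cf_mx l)^T.
Proof.
elim: l => [|a l IH]; first by rewrite trmx1.
rewrite rev_cons cf_mx_rcons IH cf_mx_cons trmx_mul; congr (_ *m _).
by apply/matrixP => i j; rewrite !mxE; case: (i =P 0); case: (j =P 0).
Qed.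

Lemma det_cf_mx l : \det (cf_mx l) = (-1) ^+ size l.
Proof.
elim: l => [|a l IH]; first by rewrite det1.
by rewrite cf_mx_cons det_mulmx IH det2E !mxE /= mulr0 mul1r sub0r exprS.
Qed.

Lemma det_cf_mx2 l :
  let A := cf_mx l in A 0 0 * A 1 1 - A 0 1 * A 1 0 = (-1) ^+ size l.
Proof. by rewrite /= -det2E det_cf_mx. Qed.

(** * Complete quotients of an irrational number *)

(** Stated with integers because the relations to which it is applied come from
    entries of convergent matrices. *)
Definition irrat {R : realType} (u : R) : Prop :=
  forall p q : int, q != 0 -> q%:~R * u <> p%:~R.

Definition complete_quotient {R : realType} (u : R) (k : nat) : R :=
  iter k cf_step u.

Definition convergent_mx {R : realType} (u : R) (k : nat) : 'M[int]_2 :=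
  cf_mx (mkseq (cf_quotient u) k).

Lemma irrat_neq0 (R : realType) (u : R) (q p : int) :
  irrat u -> q%:~R * u = p%:~R -> q = 0 /\ p = 0.
Proof.
move=> iu; have [->|q0 /(iu _ _ q0) //] := eqVneq q 0.
rewrite mul0r => /eqP; rewrite eq_sym intr_eq0 => /eqP; by [].
Qed.

Lemma irrat_int (R : realType) (u : R) (a : int) :
  irrat u -> u != a%:~R.
Proof.
by move=> iu; apply/eqP => e; apply: (iu a 1); rewrite // mul1r.
Qed.

Lemma floor_itv_irrat (R : realType) (u : R) :
  irrat u -> 0 < u - (Num.floor u)%:~R < 1.
Proof.
move=> iu; have /andP[] := floor_itv u.
rewrite le_eqVlt eq_sym (negPf (irrat_int _ iu)) /= intrD => h1 h2.
by lra.
Qed.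

Lemma cf_step_irrat (R : realType) (u : R) : irrat u -> irrat (cf_step u).
Proof.
move=> iu p q q0 e; have /andP[h _] := floor_itv_irrat iu.
move: h e; rewrite /cf_step; set f := Num.floor u => h e.
have e2 : p%:~R * u = (q + p * f)%:~R.
  have h0 : u - f%:~R != 0 by rewrite gt_eqF.
  have : p%:~R * (u - f%:~R) = q%:~R by rewrite -e mulfVK.
  by rewrite intrD intrM => <-; ring.
have [p0 _] := irrat_neq0 iu e2.
move/eqP: e; rewrite p0 mulf_eq0 intr_eq0 (negPf q0) /= invr_eq0.
by rewrite gt_eqF.
Qed.

Lemma cf_step_gt1 (R : realType) (u : R) : irrat u -> 1 < cf_step u.
Proof.
move=> iu; have /andP[h0 h1] := floor_itv_irrat iu.
by rewrite /cf_step invf_gt1.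
Qed.

Lemma complete_quotient_irrat (R : realType) (u : R) k :
  irrat u -> irrat (complete_quotient u k).
Proof. by move=> iu; elim: k => //= k IH; apply: cf_step_irrat. Qed.

Lemma complete_quotient_gt1 (R : realType) (u : R) k :
  irrat u -> 1 < complete_quotient u k.+1.
Proof.
by move=> iu /=; apply/cf_step_gt1/complete_quotient_irrat.
Qed.

Lemma complete_quotientS (R : realType) (u : R) k : irrat u ->
  complete_quotient u k * complete_quotient u k.+1 =
  (cf_quotient u k)%:~R * complete_quotient u k.+1 + 1.
Proof.
move=> iu; have ik := complete_quotient_irrat (k:=k) iu.
rewrite /= /cf_step /cf_quotient -/(complete_quotient u k).
have /andP[h _] := floor_itv_irrat ik.
have h0 : complete_quotient u k - (Num.floor (complete_quotient u k))%:~R != 0.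
  by rewrite gt_eqF.
by field.
Qed.

Lemma cf_quotient_ge1 (R : realType) (u : R) k :
  irrat u -> 1 <= cf_quotient u k.+1.
Proof.
move=> iu; suff : 0 < cf_quotient u k.+1 by lia.
by rewrite /cf_quotient floor_gt0; exact/ltW/complete_quotient_gt1.
Qed.

Lemma convergent_mxS (R : realType) (u : R) k :
  convergent_mx u k.+1 = convergent_mx u k *m quotient_mx (cf_quotient u k).
Proof. by rewrite /convergent_mx mkseqS cf_mx_rcons. Qed.

Lemma convergent_mxS0 (R : realType) (u : R) k i :
  convergent_mx u k.+1 i 0 =
  convergent_mx u k i 0 * cf_quotient u k + convergent_mx u k i 1.
Proof. by rewrite convergent_mxS mulmx2E !mxE /= mulr1. Qed.

Lemma convergent_mxS1 (R : realType) (u : R) k i :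
  convergent_mx u k.+1 i 1 = convergent_mx u k i 0.
Proof. by rewrite convergent_mxS mulmx2E !mxE /= mulr1 mulr0 addr0. Qed.

Lemma det_convergent_mx (R : realType) (u : R) k :
  let A := convergent_mx u k in A 0 0 * A 1 1 - A 0 1 * A 1 0 = (-1) ^+ k.
Proof. by rewrite /= /convergent_mx det_cf_mx2 size_mkseq. Qed.

(** Each step u_k = a_k + 1 / u_(k+1) is the Moebius transformation of a
    quotient_mx, so their product maps the k-th complete quotient to u. Clearing
    denominators spares the proof that they do not vanish. *)
Lemma convergent_mxP (R : realType) (u : R) k : irrat u ->
  let A := convergent_mx u k in let t := complete_quotient u k in
  u * ((A 1 0)%:~R * t + (A 1 1)%:~R) = (A 0 0)%:~R * t + (A 0 1)%:~R.
Proof.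
move=> iu; elim: k => [|k IH].
  by rewrite /convergent_mx /= !mxE /= mul0r mul1r add0r addr0 mulr1.
have S := complete_quotientS k iu.
move: IH; cbv zeta; rewrite !convergent_mxS0 !convergent_mxS1 !intrD !intrM.
move: S; move: (complete_quotient u k) (complete_quotient u k.+1) => t t'.
move: (convergent_mx u k) (cf_quotient u k) => A a S IH.
transitivity (u * ((A 1 0)%:~R * (a%:~R * t' + 1) + (A 1 1)%:~R * t')).
  by ring.
rewrite -S.
transitivity (u * ((A 1 0)%:~R * t + (A 1 1)%:~R) * t'); first by ring.
rewrite IH.
transitivity ((A 0 0)%:~R * (t * t') + (A 0 1)%:~R * t'); first by ring.
by rewrite S; ring.
Qed.

(** The empty product is the identity matrix, whose first column (1, 0) is the
    fraction usually indexed by -1: numer u k / denom u k is [a_0, ..., a_(k-1)]. *)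
Definition denom {R : realType} (u : R) (k : nat) : int := convergent_mx u k 1 0.
Definition numer {R : realType} (u : R) (k : nat) : int := convergent_mx u k 0 0.

Lemma denom0 (R : realType) (u : R) : denom u 0 = 0.
Proof. by rewrite /denom /convergent_mx /= mxE. Qed.

Lemma denom1 (R : realType) (u : R) : denom u 1 = 1.
Proof. by rewrite /denom convergent_mxS0 /convergent_mx /= !mxE /= mul0r add0r. Qed.

Lemma denomSS (R : realType) (u : R) k :
  denom u k.+2 = denom u k.+1 * cf_quotient u k.+1 + denom u k.
Proof. by rewrite /denom convergent_mxS0 convergent_mxS1. Qed.

Lemma denom_ge0 (R : realType) (u : R) k : irrat u ->
  0 <= denom u k /\ 1 <= denom u k.+1.
Proof.
move=> iu; elim: k => [|k [h1 h2]]; first by rewrite denom0 denom1.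
have := cf_quotient_ge1 k iu; rewrite denomSS.
move: (cf_quotient _ _) (denom u k) (denom u k.+1) h1 h2 => a q q' h1 h2 h.
by split; [lia | nia].
Qed.

Lemma denom_leD (R : realType) (u : R) k : irrat u ->
  denom u k.+1 + denom u k <= denom u k.+2.
Proof.
move=> iu; have [h1 h2] := denom_ge0 k iu.
rewrite denomSS lerD2r ler_peMr ?cf_quotient_ge1 //; lia.
Qed.

Lemma denom_ge (R : realType) (u : R) k : irrat u -> k%:Z <= denom u k.+1.
Proof.
move=> iu; elim: k => [|[|k] IH]; first by rewrite denom1.
  by have [_] := denom_ge0 1 iu.
have := denom_leD k.+1 iu; have [_ h2] := denom_ge0 k iu; lia.
Qed.

Lemma denom_le (R : realType) (u : R) k l : irrat u -> (k <= l)%N ->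
  denom u k <= denom u l.
Proof.
move=> iu /subnK <-; elim: (l - k)%N => // {}l IH.
rewrite addSn; apply: (le_trans IH); case: (l + k)%N => [|j].
  by rewrite denom0 denom1.
by have := denom_leD j iu; have [h1 h2] := denom_ge0 j iu; lia.
Qed.

(** Two successive denominators can only agree when both are 1. *)
Lemma denom_lt (R : realType) (u : R) k l : irrat u -> (k < l)%N ->
  1 < denom u l -> denom u k < denom u l.
Proof.
move=> iu; case: l => // l; rewrite ltnS => kl l1.
apply: le_lt_trans (denom_le iu kl) _.
case: l l1 {kl} => [|[|l]]; rewrite ?denom0 ?denom1 //.
by have := denom_leD l.+1 iu; have [h1 h2] := denom_ge0 l iu; lia.
Qed.

(** Solving convergent_mxP for q u - p leaves the determinant, which is 1 or -1,
    over q t + q' with t > 1. *)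
Lemma convergent_error (R : realType) (u : R) k : irrat u ->
  `|(denom u k.+1)%:~R * u - (numer u k.+1)%:~R| <= ((denom u k.+1)%:~R)^-1.
Proof.
move=> iu; have [h1 h2] := denom_ge0 k iu.
have P := convergent_mxP k.+1 iu; have D := det_convergent_mx u k.+1.
have t1 := complete_quotient_gt1 k iu.
move: P D t1; cbv zeta; rewrite !convergent_mxS1 -/(denom u k).
rewrite -/(denom u k.+1) -/(numer u k.+1).
move: (complete_quotient u k.+1) (convergent_mx _ _ _ _) h1 h2 => t c.
move: (denom u k) (denom u k.+1) (numer u k.+1) => q' q p h1 h2 P D t1.
have q1 : 1 <= q%:~R :> R by rewrite -[1]/(1%:~R) ler_int.
have q0 : 0 <= q'%:~R :> R by rewrite ler0z.
have den0 : 0 < q%:~R * t + q'%:~R :> R by nra.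
have -> : q%:~R * u - p%:~R = - (-1) ^+ k.+1 / (q%:~R * t + q'%:~R) :> R.
  apply/(canRL (mulfK (lt0r_neq0 den0))).
  rewrite mulrBl -mulrA P.
  have := congr1 (fun z : int => z%:~R : R) D.
  rewrite intrB !intrM rmorphXn rmorphN1 => <-; ring.
rewrite normrM normrN normrX normrN1 expr1n mul1r normfV gtr0_norm //.
rewrite lef_pV2 ?posrE //; nra.
Qed.

(** Both numbers are within 1 / q^2 of the same convergents p / q, and q is
    unbounded. *)
Lemma cf_quotient_inj (R : realType) (u v : R) : irrat u -> irrat v ->
  (forall k, cf_quotient u k = cf_quotient v k) -> u = v.
Proof.
move=> iu iv uv; apply/eqP; rewrite -subr_eq0 -normr_le0.
have C k : convergent_mx u k = convergent_mx v k.
  by rewrite /convergent_mx (eq_mkseq uv).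
apply/ler_addgt0Pr => e e0; rewrite add0r.
pose k := (Num.truncn (2 / e)).+1.
have ke : 2 / e < k%:R by apply: truncnS_gt.
have eu := convergent_error k iu; have ev := convergent_error k iv.
move: eu ev (denom_ge k iu); rewrite /denom /numer -C.
have : 1 <= k%:Z by [].
move: (convergent_mx _ _ 1 0) (convergent_mx _ _ 0 0) => q p k1 eu ev kq.
have q1 : 1 <= q%:~R :> R by rewrite -[1]/(1%:~R) ler_int; lia.
have qk : k%:R <= q%:~R :> R by rewrite -[k%:R]/(k%:Z%:~R) ler_int.
have h : `|q%:~R * (u - v)| <= 2 / q%:~R.
  have -> : q%:~R * (u - v) =
    (q%:~R * u - p%:~R) - (q%:~R * v - p%:~R) by ring.
  by apply: le_trans (ler_normB _ _) _; lra.
rewrite normrM gtr0_norm in h; last by lra.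
have h2 : 2 / q%:~R <= e.
  rewrite ler_pdivrMr; last by lra.
  by rewrite -ler_pdivrMl // mulrC; lra.
have := normr_ge0 (u - v); nra.
Qed.

(** * Units of the quadratic order *)

(** The norm of P - Q u, where u is a root of X^2 - c X - m. *)
Definition qnorm (c m P Q : int) : int := P ^+ 2 - c * P * Q - m * Q ^+ 2.

Lemma qnormE (R : realType) (u : R) (c m P Q : int) :
  u ^+ 2 = c%:~R * u + m%:~R ->
  (qnorm c m P Q)%:~R =
  (Q%:~R * u - P%:~R) * ((Q%:~R * u - P%:~R) - Q%:~R * (2 * u - c%:~R)).
Proof.
move=> e; rewrite /qnorm !expr2 !intrB !intrM.
have -> : m%:~R = u ^+ 2 - c%:~R * u by rewrite e; ring.
by ring.
Qed.

Lemma qnorm_neq0 (R : realType) (u : R) (c m P Q : int) :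
  u ^+ 2 = c%:~R * u + m%:~R -> irrat u -> Q != 0 -> qnorm c m P Q != 0.
Proof.
move=> e iu Q0; rewrite -(intr_eq0 R) (qnormE _ _ e) mulf_eq0 negb_or.
apply/andP; split; apply/eqP => h.
  by apply: (iu P Q) => //; apply/eqP; rewrite -subr_eq0 h.
apply: (iu (c * Q - P) Q) => //; rewrite intrB intrM.
by apply/eqP; rewrite -subr_eq0 -oppr_eq0; apply/eqP; rewrite -h; ring.
Qed.

(** Of the two conjugate factors of the norm of a convergent p / q, one is at
    most 1 / q and the other differs from it by q (2 u - c). *)
Lemma qnorm_convergent (R : realType) (u : R) (c m : int) k :
  u ^+ 2 = c%:~R * u + m%:~R -> irrat u ->
  `|(qnorm c m (numer u k.+1) (denom u k.+1))%:~R| <= 1 + `|2 * u - c%:~R|.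
Proof.
move=> e iu; rewrite (qnormE _ _ e).
have E := convergent_error k iu; have [_ h] := denom_ge0 k iu.
move: E h; move: (denom _ _) (numer _ _) => q p E h.
have q1 : 1 <= q%:~R :> R by rewrite -[1]/(1%:~R) ler_int.
move: E; set b := _ - _; set D := 2 * u - _ => E.
rewrite mulrBr; apply: le_trans (ler_normB _ _) _.
have b1 : `|b| <= 1 by apply: le_trans E _; rewrite invf_le1 //; lra.
apply: lerD; first by rewrite normrM; have := normr_ge0 b; nra.
rewrite !normrM mulrA [`|q%:~R|]gtr0_norm; last by lra.
rewrite ler_piMl // -ler_pdivlMr; last by lra.
by rewrite mul1r.
Qed.

Lemma pigeonhole (T : finType) (f : nat -> T) :
  exists i j, (i < j)%N /\ f i = f j.
Proof.
have /injectivePn [i [j ij fij]] : ~~ injectiveb (fun i : 'I_#|T|.+1 => f i).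
  apply/injectiveP => /leq_card; rewrite card_ord ltnn; by [].
move: ij; rewrite -val_eqE /= neq_ltn => /orP[] ij.
  by exists i, j.
by exists j, i.
Qed.

(** The arguments on the left are the coordinates of the product of P - Q u with
    the conjugate of P' - Q' u. *)
Lemma qnorm_quotient (c m P Q P' Q' : int) :
  qnorm c m (P * P' - c * P * Q' - m * Q * Q') (Q * P' - P * Q') =
  qnorm c m P Q * qnorm c m P' Q'.
Proof. by rewrite /qnorm; ring. Qed.

(** Infinitely many convergents have a norm below a fixed bound, so two of them
    have the same norm N and agree modulo N; their quotient is a unit. *)
Lemma pell_exists (R : realType) (u : R) (c m : int) :
  u ^+ 2 = c%:~R * u + m%:~R -> irrat u ->
  exists P Q : int, 0 < Q /\ qnorm c m P Q = 1.
Proof.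
move=> e iu.
pose p k := numer u k.+2; pose q k := denom u k.+2.
pose N k := qnorm c m (p k) (q k).
have q0 k : 0 < q k by have [_ h] := denom_ge0 k.+1 iu; rewrite /q; lia.
have N0 k : N k != 0 by apply: (qnorm_neq0 _ e iu); have := q0 k; lia.
have [B NB] : exists B : nat, forall k, (`|N k| <= B)%N.
  exists (Num.truncn (1 + `|2 * u - c%:~R|)).+1 => k.
  have := qnorm_convergent k.+1 e iu; rewrite -/(p k) -/(q k) -/(N k).
  have := truncnS_gt (1 + `|2 * u - c%:~R|); move: (Num.truncn _) => b h1 h2.
  have := le_lt_trans h2 h1.
  rewrite -intr_norm -abszE -[X in _ < X]/((b.+1%:Z)%:~R) ltr_int.
  by lia.
pose f k : 'I_(2 * B).+1 * ('I_B.+1 * 'I_B.+1) :=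
  (inord `|N k + B%:Z|, (inord `|(p k %% N k)%Z|, inord `|(q k %% N k)%Z|)).
have [i [j [ij]]] := pigeonhole f.
have modB x k : (`|(x %% N k)%Z| < B.+1)%N.
  have := ltz_mod x (N0 k); have := modz_ge0 x (N0 k); have := NB k; lia.
move=> [] /(congr1 val) + /(congr1 val) + /(congr1 val).
have NBB k : (`|(N k + B%:Z)%R| < (2 * B).+1)%N by have := NB k; lia.
have inordE n k : (k < n.+1)%N -> val (inord k : 'I_n.+1) = k by exact: inordK.
rewrite (inordE _ _ (NBB i)) (inordE _ _ (NBB j)).
rewrite (inordE _ _ (modB (p i) i)) (inordE _ _ (modB (p j) j)).
rewrite (inordE _ _ (modB (q i) i)) (inordE _ _ (modB (q j) j)) => eN ep eq.
have {}eN : N i = N j.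
  by move: (NB i) (NB j) eN; clear; move: (N i) (N j); lia.
have {}ep : (p i = p j %[mod N i])%Z.
  by rewrite -[LHS]gez0_abs ?modz_ge0 // ep -eN gez0_abs ?modz_ge0.
have {}eq : (q i = q j %[mod N i])%Z.
  by rewrite -[LHS]gez0_abs ?modz_ge0 // eq -eN gez0_abs ?modz_ge0.
have /dvdzP[x xE] : (N i %| p i - p j)%Z by rewrite -eqz_mod_dvd; apply/eqP.
have /dvdzP[y yE] : (N i %| q i - q j)%Z by rewrite -eqz_mod_dvd; apply/eqP.
(* Substituting the congruences p_j = p_i - x N and q_j = q_i - y N in the
   product of qnorm_quotient shows that it is divisible by N: the quotient
   is X - Y u. *)
have pj : p j = p i - x * N i by rewrite -xE; ring.
have qj : q j = q i - y * N i by rewrite -yE; ring.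
pose X := 1 - p i * x + c * p i * y + m * q i * y.
pose Y := p i * y - q i * x.
have XE : X * N i = p i * p j - c * p i * q j - m * q i * q j.
  by rewrite pj qj /X; rewrite /N /qnorm; ring.
have YE : Y * N i = q i * p j - p i * q j.
  by rewrite pj qj /Y; ring.
have nXY : qnorm c m X Y = 1.
  have N2 : N i * N i != 0 by rewrite mulf_neq0.
  apply: (mulIf N2); rewrite mul1r; transitivity (N i * N j).
    rewrite /N -(qnorm_quotient c m (p i) (q i) (p j) (q j)) -XE -YE.
    by rewrite -/(N i); move: (N i) => ?; rewrite /qnorm; ring.
  by rewrite -eN.
have Y0 : Y != 0.
  apply/eqP => Y0.
  have h : q i * p j = p i * q j.
    by apply/eqP; rewrite -subr_eq0 -YE Y0 mul0r.
  have h2 : N i * q j ^+ 2 = N j * q i ^+ 2.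
    transitivity ((p i * q j) ^+ 2 - c * (p i * q j) * (q i * q j)
                    - m * (q i * q j) ^+ 2); first by rewrite /N /qnorm; ring.
    by rewrite -h /N /qnorm; ring.
  have h3 : q i ^+ 2 = q j ^+ 2.
    by apply: (mulfI (N0 i)); rewrite h2 eN.
  have qij : q i < q j.
    apply: (denom_lt iu); first by rewrite !ltnS.
    apply: lt_le_trans (denom_ge j.+1 iu).
    by move: ij; clear; case: j.
  move: (q0 i) (q0 j) h3 qij; clear; move: (q i) (q j); nia.
have [Y1|Y1] := ltP 0 Y; first by exists X, Y.
exists (- X), (- Y); split; first by lia.
by rewrite -nXY /qnorm; ring.
Qed.

(** * Parametrization of an order by one of its units *)

Definition residue_sign (r : residue) : int :=
  match r with MinusOne => -1 | PlusOne => 1 end.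

Definition is_unit_norm (N : int) : Prop := exists r, N = residue_sign r.

(** Both families D(y, x) are given by the same equation: with d = m for c = 0
    and d = 4 m + 1 for c = 1, it says that a y + x is the first coordinate of
    a unit of norm +-1 whose second coordinate is y. *)
Definition unit_param (c : int) (r : residue) (y x a : nat) (m : int) : Prop :=
  exists z w : int,
    [/\ y%:Z * z = x%:Z ^+ 2 - residue_sign r,
        w * y%:Z = (2 * a%:Z - c) * x%:Z + z
      & m = a%:Z ^+ 2 - c * a%:Z + w].

Definition quadratic_order (c m : int) : Prop :=
  [/\ c = 0 \/ c = 1, 1 <= m & forall P Q : int, 0 < Q -> qnorm c m P Q != 0].

(** The integer a is the integral part of the positive root of X^2 - c X - m,
    described by the signs of this polynomial at a and a + 1. *)
Lemma quadratic_floor (c m : int) : quadratic_order c m ->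
  exists a : nat, [/\ (0 < a)%N, a%:Z ^+ 2 - c * a%:Z - m < 0
     & 0 < (a%:Z + 1) ^+ 2 - c * (a%:Z + 1) - m].
Proof.
move=> [c01 m1 n0].
pose P (a : nat) := (0 < a)%N && (a%:Z ^+ 2 - c * a%:Z - m < 0).
have P1 : exists a, P a.
  exists 1%N; rewrite /P /=; have := n0 1 1 isT; rewrite /qnorm; lia.
have Pb a : P a -> (a <= `|m| + 1)%N.
  by move=> /andP[]; rewrite expr2; case: c01 => ->; nia.
case: (ex_maxnP P1 Pb) => a /andP[a0 am] amax; exists a; split=> //.
have := n0 (a%:Z + 1) 1 isT; have : ~~ P a.+1.
  by apply/negP => /amax; rewrite ltnn.
rewrite /P /qnorm -[a.+1]addn1 PoszD addn1 /= !expr2; lia.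
Qed.

Lemma minimal_unit (R : realType) (u : R) (c m : int) :
  u ^+ 2 = c%:~R * u + m%:~R -> irrat u ->
  exists y : nat, [/\ (0 < y)%N,
    exists P : int, is_unit_norm (qnorm c m P y%:Z)
    & forall P Q : int, 0 < Q -> is_unit_norm (qnorm c m P Q) -> y%:Z <= Q].
Proof.
move=> e iu; have [P0 [Q0 [Q00 N1]]] := pell_exists e iu.
pose S (y : nat) :=
  `[< (0 < y)%N /\ exists P : int, is_unit_norm (qnorm c m P y%:Z) >].
have ES : exists y, S y.
  exists `|Q0|%N; apply/asboolP; split; first by lia.
  by exists P0, PlusOne; rewrite gez0_abs // ltW.
case: (ex_minnP ES) => y /asboolP[y0 yP] ymin; exists y; split=> // P Q Q1 PQ.
have /ymin : S `|Q|%N; last by lia.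
apply/asboolP; split; first by lia.
by exists P; rewrite gez0_abs // ltW.
Qed.

(** Replacing P by its conjugate c y - P makes it the larger of the two. For
    y > 1 it then lies strictly between a y and (a + 1) y, where a is the
    integral part of the root, since the norm is at most - y^2 at the former and
    at least y^2 at the latter; so a is the parameter and x = P - a y. For y = 1
    the remainder has to be 0, and a = P. *)
Lemma unit_param_exists (c m : int) (y : nat) (P : int) : quadratic_order c m ->
  (0 < y)%N -> is_unit_norm (qnorm c m P y%:Z) ->
  exists r (x a : nat), [/\ (x < y)%N, (0 < a)%N & unit_param c r y x a m].
Proof.
move=> qo y0 [r]; wlog Py : P / c * y%:Z <= 2 * P => [WL|] N.
  have [/WL|h] := leP (c * y%:Z) (2 * P); first exact.
  apply: (WL (c * y%:Z - P)); first by lia.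
  by rewrite -N /qnorm; ring.
have [c01 m1 n0] := qo.
have [y1|y1] := leqP y 1.
  have y1E : y = 1%N by lia.
  move: N n0 Py; rewrite y1E /qnorm => N n0 Py.
  have P1 : 1 <= P.
    have := n0 1 1 isT; case: c01 N Py => ->; case: r => /=; rewrite !expr2; nia.
  exists r, 0%N, `|P|%N; split; [by []|lia|].
  exists (- residue_sign r), (- residue_sign r).
  rewrite gez0_abs; last by lia.
  split; [by ring | by ring |].
  by rewrite -N; ring.
have [a [a0 am aM]] := quadratic_floor qo.
set s := residue_sign r in N; have s1 : -1 <= s <= 1 by rewrite /s; case: (r).
have xge0 : a%:Z * y%:Z <= P.
  rewrite leNgt; apply/negP => h.
  move: am N Py h; rewrite /qnorm => am N Py h.
  have : s <= (a%:Z ^+ 2 - c * a%:Z - m) * y%:Z ^+ 2.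
    rewrite -N -subr_ge0.
    have -> : (a%:Z ^+ 2 - c * a%:Z - m) * y%:Z ^+ 2 -
      (P ^+ 2 - c * P * y%:Z - m * y%:Z ^+ 2) =
      (a%:Z * y%:Z - P) * (a%:Z * y%:Z + P - c * y%:Z) by ring.
    by apply: mulr_ge0; lia.
  by rewrite expr2; nia.
have xlt : P < (a%:Z + 1) * y%:Z.
  rewrite ltNge; apply/negP => h.
  move: aM N Py h; rewrite /qnorm => aM N Py h.
  have : ((a%:Z + 1) ^+ 2 - c * (a%:Z + 1) - m) * y%:Z ^+ 2 <= s.
    rewrite -N -subr_ge0.
    have -> : (P ^+ 2 - c * P * y%:Z - m * y%:Z ^+ 2) -
      ((a%:Z + 1) ^+ 2 - c * (a%:Z + 1) - m) * y%:Z ^+ 2 =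
      (P - (a%:Z + 1) * y%:Z) * ((a%:Z + 1) * y%:Z + P - c * y%:Z) by ring.
    apply: mulr_ge0; first by lia.
    by case: c01 => ->; nia.
  by rewrite [y%:Z ^+ 2]expr2; nia.
have xE : `|(P - a%:Z * y%:Z)%R|%N%:Z = P - a%:Z * y%:Z by rewrite gez0_abs; lia.
exists r, `|(P - a%:Z * y%:Z)%R|%N, a; split=> //; first by lia.
rewrite /unit_param xE -/s -N.
exists (m * y%:Z - a%:Z ^+ 2 * y%:Z - (2 * a%:Z - c) * (P - a%:Z * y%:Z)
        + c * a%:Z * y%:Z), (m - a%:Z ^+ 2 + c * a%:Z).
by split; rewrite /qnorm; ring.
Qed.

(** * The period of the expansion attached to a unit *)

(** The value of the continued fraction [l_0, ..., l_(n-1), t]. *)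
Definition cf_tail {R : realType} (l : seq int) (t : R) : R :=
  foldr (fun b v => b%:~R + v^-1) t l.

Lemma cf_tail_gt1 (R : realType) (l : seq int) (t : R) :
  all (fun b => 1 <= b) l -> 1 < t -> 1 < cf_tail l t.
Proof.
move=> + t1; elim: l => //= b l IH /andP[b1 /IH h].
have b1' : 1 <= b%:~R :> R by rewrite -[1]/(1%:~R) ler_int.
by apply: le_lt_trans b1' _; rewrite ltrDl invr_gt0; lra.
Qed.

Lemma floor_cf_tail (R : realType) (b : int) (v : R) :
  1 < v -> Num.floor (b%:~R + v^-1) = b.
Proof.
move=> v1; apply: floor_def.
have h0 : 0 < v^-1 by rewrite invr_gt0; lra.
have h1 : v^-1 < 1 by rewrite invf_lt1; lra.
by rewrite intrD; apply/andP; split; lra.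
Qed.

Lemma cf_quotient_tail (R : realType) (b : int) (l : seq int) (t : R) :
  all (fun b => 1 <= b) l -> 1 < t ->
  let u := cf_tail (b :: l) t in
  mkseq (cf_quotient u) (size l).+1 = b :: l /\
  complete_quotient u (size l).+1 = t.
Proof.
move=> + t1; elim: l b => [|b' l IH] b lP u.
  have fu : Num.floor u = b by apply: floor_cf_tail.
  split; first by rewrite /mkseq /= /cf_quotient /= fu.
  by rewrite /complete_quotient /= /cf_step fu /u /= addrC addKr invrK.
have v1 := cf_tail_gt1 lP t1.
have fu : Num.floor u = b by apply: floor_cf_tail.
have su : cf_step u = cf_tail (b' :: l) t.
  by rewrite /cf_step fu /u /= addrC addKr invrK.
move: lP => /andP[_ /IH] /(_ b') [IH1 IH2]; split.
  rewrite -[size _]/(size l).+1 /mkseq -[iota _ _]/(0%N :: iota 1 (size l).+1).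
  rewrite map_cons {1}/cf_quotient [iter 0 _ _]/= fu; congr (_ :: _).
  rewrite (iotaDl 1 0) -map_comp -[RHS]IH1; apply: eq_map => k.
  by rewrite /= /cf_quotient iterSr su.
by rewrite /complete_quotient iterSr su.
Qed.

Lemma cf_tailP (R : realType) (l : seq int) (t : R) :
  all (fun b => 1 <= b) (behead l) -> 1 < t -> let A := cf_mx l in
  cf_tail l t * ((A 1 0)%:~R * t + (A 1 1)%:~R) = (A 0 0)%:~R * t + (A 0 1)%:~R.
Proof.
move=> + t1; elim: l => [|b l IH] lP /=.
  by rewrite !mxE /= mul0r mul1r add0r addr0 mulr1.
have v0 : cf_tail l t != 0.
  by case: l lP {IH} => [|b' l] lP; rewrite gt_eqF // (lt_trans ltr01) //=;
     apply: (cf_tail_gt1 (l := b' :: l)).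
have /IH : all (fun b => 1 <= b) (behead l) by case: (l) lP => //= ? ? /andP[].
rewrite /= !mulmx2E !mxE /= !mul1r !mul0r !addr0 !intrD !intrM.
move: (cf_tail l t) (cf_mx l) v0 => v A v0 IHl.
transitivity (b%:~R * ((A 0 0)%:~R * t + (A 0 1)%:~R)
  + v^-1 * ((A 0 0)%:~R * t + (A 0 1)%:~R)); first by ring.
by rewrite -{2}IHl mulKf //; ring.
Qed.

Lemma cf_eval_mx (l : seq nat) : all (ltn 0) l ->
  let A := cf_mx (map Posz l) in
  [/\ 0 < A 0 0, 0 <= A 1 0 & cf_eval l = (A 1 0)%:~R / (A 0 0)%:~R].
Proof.
elim: l => [|b l IH] /=; first by rewrite !mxE /= mul0r.
move=> /andP[b0 /IH]; rewrite !mulmx2E !mxE /= !mul1r !mul0r !addr0.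
move: (cf_mx _) => A [h1 h2 ->]; split; [nia | lia |].
rewrite intrD intrM -[b%:R]/(b%:Z%:~R).
have h3 : 0 < (A 0 0)%:~R :> rat by rewrite ltr0z.
have h4 : 0 <= (A 1 0)%:~R :> rat by rewrite ler0z.
have h5 : 0 < b%:Z%:~R :> rat by rewrite ltr0z.
rewrite -[RHS]invf_div; congr (_^-1); field; by rewrite gt_eqF.
Qed.

(** Reversing the expansion transposes the matrix, and its first column has
    coprime entries with quotient x / y, as x and y do. *)
Lemma symmetric_cf_mx (r : residue) (y x : nat) (l : seq nat) (z : int) :
  (0 < y)%N -> y%:Z * z = x%:Z ^+ 2 - residue_sign r ->
  all (ltn 0) l -> rev l = l -> cf_eval l = x%:R / y%:R ->
  odd (size l) = (if r is PlusOne then true else false) ->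
  let A := cf_mx (map Posz l) in
  [/\ A 0 0 = y%:Z, A 0 1 = x%:Z, A 1 0 = x%:Z & A 1 1 = z].
Proof.
move=> y0 yz lP lrev lE lodd.
have [] := cf_eval_mx lP; rewrite lE.
have S : (cf_mx (map Posz l)) 0 1 = (cf_mx (map Posz l)) 1 0.
  by rewrite -[in RHS]lrev map_rev cf_mx_rev [in RHS]mxE.
have := det_cf_mx2 (map Posz l); rewrite /= S.
have -> : (-1) ^+ size (map Posz l) = - residue_sign r.
  by rewrite size_map -signr_odd lodd; case: (r).
move: (cf_mx _) S => A S D A0 A1 E.
have {}E : A 1 0 * y%:Z = x%:Z * A 0 0.
  apply/eqP; rewrite -(eqr_int rat) !intrM; apply/eqP.
  have h3 : (A 0 0)%:~R != 0 :> rat by rewrite intr_eq0; lia.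
  have h4 : y%:Z%:~R != 0 :> rat by rewrite intr_eq0; lia.
  by rewrite -[x%:Z%:~R](mulfVK h4) [_ / _]E; field.
set s := residue_sign r in yz D; have ss : s * s = 1 by rewrite /s; case: (r).
have [k1 d1] : exists k, y%:Z = k * A 0 0.
  exists (- s * (y%:Z * A 1 1 - x%:Z * A 1 0)).
  transitivity (s * s * y%:Z); first by rewrite ss mul1r.
  transitivity (- s * (A 0 0 * A 1 1 - A 1 0 * A 1 0) * y%:Z).
    by rewrite D; ring.
  transitivity (- s * (A 0 0 * A 1 1 * y%:Z - A 1 0 * (A 1 0 * y%:Z))).
    by ring.
  by rewrite E; ring.
have [k2 d2] : exists k, A 0 0 = k * y%:Z.
  exists (s * (x%:Z * A 1 0 - z * A 0 0)).
  transitivity (s * s * A 0 0); first by rewrite ss mul1r.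
  transitivity (s * (x%:Z * (x%:Z * A 0 0) - y%:Z * z * A 0 0)).
    by rewrite yz; ring.
  by rewrite -E; ring.
have A00 : A 0 0 = y%:Z.
  have y0' : 0 < y%:Z by [].
  have k10 : 0 < k1 by rewrite -(pmulr_lgt0 _ A0) -d1.
  have k20 : 0 < k2 by rewrite -(pmulr_lgt0 _ y0') -d2.
  by apply: le_anti; apply/andP; split; [rewrite [leRHS]d1 | rewrite [leRHS]d2];
     rewrite ler_peMl; lia.
have y0' : y%:Z != 0 by lia.
have A10 : A 1 0 = x%:Z by apply: (mulIf y0'); rewrite E A00.
split=> //; apply: (mulfI y0'); rewrite yz.
by rewrite -{1}A00 -[LHS](subrK (A 1 0 * A 1 0)) D A10; ring.
Qed.

(** The default value 0 of cf_period is not taken once some period exists. *)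
Lemma cf_period_eventual (R : realType) (u : R) (p : nat) :
  cf_eventual_period u p -> cf_eventual_period u (cf_period u).
Proof.
move=> up; pose S p := `[< cf_eventual_period u p >].
have ES : exists p, S p by exists p; apply/asboolP.
rewrite /cf_period; case: xgetP => [q _ []//|/(_ (ex_minn ES)) []].
case: ex_minnP => q /asboolP qP qmin; split=> // e eP.
exact/qmin/asboolP.
Qed.

(** Since u and its p-th complete quotient have the same fractional part, the
    latter is u + h for an integer h. Then convergent_mxP is a quadratic equation
    for u, hence a multiple of u^2 = c u + m, and comparing coefficients turns the
    determinant of the convergent matrix into the norm. *)
Lemma qnorm_period (R : realType) (u : R) (c m : int) (p : nat) :
  u ^+ 2 = c%:~R * u + m%:~R -> irrat u ->
  complete_quotient u p.+1 = complete_quotient u 1 ->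
  is_unit_norm (qnorm c m (numer u p) (denom u p)).
Proof.
move=> e iu; rewrite /= /cf_step => /invr_inj.
set f := Num.floor _; set g := Num.floor _ => E.
have {}E : complete_quotient u p = u + (f - g)%:~R.
  by apply: (addIr (- f%:~R)); rewrite E intrB; ring.
have := convergent_mxP p iu; have := det_convergent_mx u p.
rewrite /= E /numer /denom; move: (f - g) (convergent_mx u p) => h A D M.
have M2 : (c * A 1 0 + A 1 0 * h + A 1 1 - A 0 0)%:~R * u =
    (A 0 0 * h + A 0 1 - A 1 0 * m)%:~R.
  rewrite !(intrD, intrB, intrM).
  transitivity (u * ((A 1 0)%:~R * (u + h%:~R) + (A 1 1)%:~R)
    - (A 1 0)%:~R * (u ^+ 2) + (c%:~R * (A 1 0)%:~R - (A 0 0)%:~R) * u).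
    by ring.
  by rewrite M e; ring.
have [M3 M4] := irrat_neq0 iu M2.
exists (if odd p then MinusOne else PlusOne).
transitivity ((-1) ^+ p : int); last by rewrite -signr_odd; case: (odd p).
rewrite -D /qnorm.
transitivity (A 0 0 * (A 0 0 - c * A 1 0) - A 1 0 * (A 1 0 * m)); first by ring.
have -> : A 1 0 * m = A 0 0 * h + A 0 1.
  by apply/eqP; rewrite eq_sym -subr_eq0 M4.
have -> : A 0 0 - c * A 1 0 = A 1 0 * h + A 1 1.
  by apply/eqP; rewrite eq_sym -subr_eq0 -M3; apply/eqP; ring.
by ring.
Qed.

Lemma cf_quotient_complete (R : realType) (u : R) k l :
  cf_quotient (complete_quotient u k) l = cf_quotient u (l + k).
Proof. by rewrite /cf_quotient /complete_quotient iterD. Qed.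

(** The parametrization makes u a fixed point of [a; a1, ..., an, u + a - c], so
    n + 1 is a period. A smaller one would give a unit with a smaller second
    coordinate. *)
Lemma cf_period_gt (R : realType) (u : R) (c m : int) (r : residue)
    (y x a n : nat) :
  u ^+ 2 = c%:~R * u + m%:~R -> irrat u -> 0 < u -> 1 <= m ->
  (1 < y)%N -> (0 < a)%N -> unit_param c r y x a m ->
  symmetric_length r y x n ->
  (forall P Q : int, 0 < Q -> is_unit_norm (qnorm c m P Q) -> y%:Z <= Q) ->
  (n < cf_period u)%N.
Proof.
move=> e iu u0 m1 y1 a0 [z [w [yz wE mE]]].
rewrite /symmetric_length; case: eqP => [[y1']|_]; first by rewrite y1' in y1.
move=> [l [sl lP lrev lE lodd]] ymin.
rewrite -sl in lodd *.
have [A00 A01 A10 A11] := symmetric_cf_mx (ltnW y1) yz lP lrev lE lodd.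
pose t := u + (a%:Z - c)%:~R.
have m1' : 1 <= m%:~R :> R by rewrite -[1]/(1%:~R) ler_int.
have a1' : 1 <= a%:Z%:~R :> R by rewrite -[1]/(1%:~R) ler_int.
have t1 : 1 < t.
  have : 0 < u * (u - c%:~R) by rewrite mulrBr -expr2 e; lra.
  by rewrite pmulr_rgt0 // /t intrB; lra.
have lP1 : all (fun b : int => 1 <= b) (map Posz l).
  by rewrite all_map; apply: sub_all lP.
have uE : u = cf_tail (a%:Z :: map Posz l) t.
  have := cf_tailP (l := a%:Z :: map Posz l) lP1 t1.
  rewrite /= -/(cf_mx _) !mulmx2E !mxE /= A00 A01 A10 A11 !mul1r !mul0r !addr0.
  set v := _ + _^-1; rewrite !(intrD, intrM).
  (* Multiplied by this denominator, u = v becomes the equation in the definition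
     of unit_param. *)
  have den0 : 0 < y%:Z%:~R * t + x%:Z%:~R :> R.
    have h1 : 0 < y%:Z%:~R :> R by rewrite ltr0z; lia.
    have h2 : 0 <= x%:Z%:~R :> R by rewrite ler0z.
    by nra.
  move=> vE; apply: (mulIf (lt0r_neq0 den0)); rewrite {}vE.
  apply/eqP; rewrite -subr_eq0; apply/eqP.
  transitivity ((u ^+ 2 - c%:~R * u) * y%:Z%:~R - (a%:Z ^+ 2 - c * a%:Z)%:~R * y%:Z%:~R
     - ((2 * a%:Z - c) * x%:Z + z)%:~R : R).
    by rewrite /t !expr2 !(intrB, intrD, intrM); ring.
  by rewrite -wE e mE !expr2 !(intrB, intrD, intrM); ring.
have [] := cf_quotient_tail a%:Z lP1 t1; cbv zeta; rewrite -uE size_map => qE tE.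
set n' := size l in qE tE *.
have un : complete_quotient u n'.+2 = complete_quotient u 1.
  rewrite -[LHS]/(cf_step (complete_quotient u n'.+1)) tE.
  rewrite -[RHS]/(cf_step u) /cf_step /t floorDrz ?intr_int // intrKfloor.
  by rewrite [(Num.floor u + _)%:~R]intrD; congr (_ ^-1); ring.
have perN k : complete_quotient u (k.+1 + n'.+1) = complete_quotient u k.+1.
  by rewrite /complete_quotient addSnnS iterD -/(complete_quotient u n'.+2) un
     -iterD addn1.
have dn : denom u n'.+1 = y%:Z.
  rewrite /denom /convergent_mx qE cf_mx_cons mulmx2E !mxE /=.
  by rewrite mul1r mul0r addr0.
rewrite ltnNge; apply/negP => pn.
have [p0 [N pN]] : cf_eventual_period u (cf_period u).
  apply: (@cf_period_eventual _ _ n'.+1); split=> //; exists 1%N => -[//|k] _.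
  by rewrite /cf_quotient -!/(complete_quotient _ _) perN.
set p := cf_period u in pn p0 pN.
have perNj j k : complete_quotient u (k.+1 + j * n'.+1) = complete_quotient u k.+1.
  elim: j k => [|j IH] k; first by rewrite mul0n addn0.
  by rewrite mulSn addnCA addnC addSn -addSn perN -addSn IH.
(* From its index N on the expansion has period p; since n + 1 is a period from
   index 1 on, p is one too. *)
have up : complete_quotient u p.+1 = complete_quotient u 1.
  have -> : complete_quotient u p.+1 = complete_quotient u (p.+1 + N * n'.+1).
    by rewrite perNj.
  rewrite -(perNj N 0%N).
  apply: cf_quotient_inj; [exact: complete_quotient_irrat | exact: complete_quotient_irrat |].
  move=> k; rewrite !cf_quotient_complete.
  have -> : (k + (p.+1 + N * n'.+1) = (k + (1 + N * n'.+1)) + p)%N by lia.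
  by rewrite pN //; nia.
have := ymin _ _ _ (qnorm_period e iu up).
have dp : 0 < denom u p by case: (p) p0 => // j _; have [_] := denom_ge0 j iu; lia.
move=> /(_ dp); apply/negP; rewrite -ltNge -dn; apply: denom_lt => //.
by rewrite dn; lia.
Qed.

(** * The families D(y, x) and their small elements *)

Lemma residue_sign_sqr r : residue_sign r * residue_sign r = 1.
Proof. by case: r. Qed.

Lemma square_residueP (r : residue) (y x : nat) :
  square_residue r y x <-> exists z, y%:Z * z = x%:Z ^+ 2 - residue_sign r.
Proof.
have -> : square_residue r y x <-> (y%:Z %| x%:Z ^+ 2 - residue_sign r)%Z.
  by rewrite -eqz_mod_dvd; case: r; split=> /eqP.
split=> [/dvdzP[z ->]|[z <-]]; last exact: dvdz_mulr.
by exists z; rewrite mulrC.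
Qed.

(** Multiplication by x, whose square is a sign modulo y, exchanges the
    integrality of d with the congruence that defines D(y, x). *)
Lemma unit_param_dvd (r : residue) (y x : nat) (b z : int) :
  y%:Z * z = x%:Z ^+ 2 - residue_sign r ->
  (exists w, w * y%:Z = b * x%:Z + z) <->
  (y%:Z %| b + residue_sign r * x%:Z * z)%Z.
Proof.
move=> yz; have ss := residue_sign_sqr r; set s := residue_sign r in yz ss *.
split=> [[w wE]|/dvdzP[w wE]].
  apply/dvdzP; exists (s * (w * x%:Z - b * z)).
  transitivity (s * (w * y%:Z * x%:Z - b * (y%:Z * z))); last by ring.
  rewrite wE yz; transitivity (s * s * b + s * x%:Z * z); last by ring.
  by rewrite ss; ring.
exists (w * x%:Z - s * z * z).
transitivity (w * y%:Z * x%:Z - s * z * (y%:Z * z)); first by ring.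
rewrite -wE yz; transitivity (b * x%:Z + s * s * z); first by ring.
by rewrite ss; ring.
Qed.

Lemma square_div (r : residue) (y x : nat) (z : int) : (0 < y)%N ->
  y%:Z * z = x%:Z ^+ 2 - residue_sign r ->
  match r with
  | MinusOne => ((1 + x%:Z ^+ 2) %/ y%:Z)%Z = z
  | PlusOne => ((1 - x%:Z ^+ 2) %/ y%:Z)%Z = - z
  end.
Proof.
move=> y0; have y0' : y%:Z != 0 by lia.
case: r => /= yz.
  have -> : 1 + x%:Z ^+ 2 = z * y%:Z by rewrite mulrC yz; ring.
  by rewrite mulzK.
have -> : 1 - x%:Z ^+ 2 = (- z) * y%:Z by rewrite mulNr mulrC yz; ring.
by rewrite mulzK.
Qed.

(** The rational equation defining D(y, x), with denominators cleared. *)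
Lemma rat_equation (r : residue) (y x : nat) (b k z d : int) : (0 < y)%N ->
  y%:Z * z = x%:Z ^+ 2 - residue_sign r ->
  d%:~R = b%:~R ^+ 2 + 2 * k%:~R * x%:Z%:~R / y%:Z%:~R * b%:~R
          + k%:~R ^+ 2 * (x%:Z%:~R ^+ 2 - (residue_sign r)%:~R) / y%:Z%:~R ^+ 2
    :> rat <->
  y%:Z * d = y%:Z * b ^+ 2 + 2 * k * x%:Z * b + k ^+ 2 * z.
Proof.
move=> y0 yz; have y0r : y%:Z%:~R != 0 :> rat by rewrite intr_eq0; lia.
have -> : x%:Z%:~R ^+ 2 - (residue_sign r)%:~R = y%:Z%:~R * z%:~R :> rat.
  by rewrite -intrM yz intrB !expr2 intrM.
split=> [h|/(congr1 (fun i : int => i%:~R : rat))].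
  apply/eqP; rewrite -(eqr_int rat); apply/eqP.
  by rewrite !expr2 !(intrD, intrM) h; field.
rewrite !expr2 !(intrD, intrM) => h; apply: (mulfI y0r); rewrite h; by field.
Qed.

Lemma D0_caseP (r : residue) (y x d : nat) : (0 < y)%N ->
  D0_case r y x d <->
  [/\ (0 < d)%N, nonsquare d &
     exists a : nat, (0 < a)%N /\ unit_param 0 r y x a d%:Z].
Proof.
move=> y0; have y0' : y%:Z != 0 by lia.
split=> [[d0 dn /square_residueP[z yz] [a [a0 aP]]]|].
  split=> //; exists a; split=> //; exists z, (d%:Z - a%:Z ^+ 2).
  split=> //; last by ring.
  have /(rat_equation a%:Z 1 d%:Z y0 yz) h : d%:Z%:~R = a%:Z%:~R ^+ 2 +
     2 * 1%:~R * x%:Z%:~R / y%:Z%:~R * a%:Z%:~R + 1%:~R ^+ 2 *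
     (x%:Z%:~R ^+ 2 - (residue_sign r)%:~R) / y%:Z%:~R ^+ 2 :> rat.
    rewrite -[LHS]/(d%:R); case: (r) aP => -[_ ->] /=; by rewrite ?intrN; ring.
  by rewrite mulrBl mulrC h; ring.
move=> [d0 dn [a [a0 [z [w [yz wE dE]]]]]]; split=> //.
  by apply/square_residueP; exists z.
exists a; split=> //; have qE := square_div y0 yz.
have := (unit_param_dvd (2 * a%:Z - 0) yz).1; move=> /(_ (ex_intro _ w wE)).
have /(rat_equation a%:Z 1 d%:Z y0 yz) : 
    y%:Z * d%:Z = y%:Z * a%:Z ^+ 2 + 2 * 1 * x%:Z * a%:Z + 1 ^+ 2 * z.
  have -> : y%:Z * d%:Z = y%:Z * a%:Z ^+ 2 + w * y%:Z by rewrite dE; ring.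
  by rewrite wE; ring.
case: (r) qE => /= -> h dv; (split;
  first by apply/eqP; rewrite eqz_mod_dvd; apply: etrans dv; congr dvdz; ring).
- transitivity (d%:Z%:~R : rat) => //; by rewrite h intrN; ring.
- transitivity (d%:Z%:~R : rat) => //; by rewrite h; ring.
Qed.

Lemma D1_caseP (r : residue) (y x d : nat) : (0 < y)%N ->
  D1_case r y x d <->
  [/\ (0 < d)%N, nonsquare d & exists a m : nat,
     [/\ (0 < a)%N, d = (4 * m + 1)%N & unit_param 1 r y x a m%:Z]].
Proof.
move=> y0; have y0' : y%:Z != 0 by lia.
split=> [[d0 dn /square_residueP[z yz] [a [a0 aP]]]|].
  have [w wE] : exists w, w * y%:Z = (2 * a%:Z - 1) * x%:Z + z.
    apply/(unit_param_dvd _ yz); have qE := square_div y0 yz.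
    case: (r) qE aP => /= -> [/eqP + _]; rewrite eqz_mod_dvd => dv;
      by apply: etrans dv; congr dvdz; ring.
  have /(rat_equation (2 * a%:Z - 1) 2 d%:Z y0 yz) h :
     d%:Z%:~R = (2 * a%:Z - 1)%:~R ^+ 2 +
     2 * 2%:~R * x%:Z%:~R / y%:Z%:~R * (2 * a%:Z - 1)%:~R + 2%:~R ^+ 2 *
     (x%:Z%:~R ^+ 2 - (residue_sign r)%:~R) / y%:Z%:~R ^+ 2 :> rat.
    rewrite -[LHS]/(d%:R); case: (r) aP => -[_ ->] /=; by rewrite ?intrN intrB intrM; ring.
  have dE : d%:Z = 4 * (a%:Z ^+ 2 - a%:Z + w) + 1.
    apply: (mulfI y0'); rewrite h.
    transitivity (y%:Z * (2 * a%:Z - 1) ^+ 2 + 4 * (w * y%:Z)); last by ring.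
    by rewrite wE; ring.
  split=> //; exists a, `|(a%:Z ^+ 2 - a%:Z + w)%R|%N; split=> //; first by lia.
  exists z, w; split=> //; rewrite gez0_abs; last by lia.
  by ring.
move=> [d0 dn [a [m [a0 dE [z [w [yz wE mE]]]]]]]; split=> //.
  by apply/square_residueP; exists z.
exists a; split=> //; have qE := square_div y0 yz.
have := (unit_param_dvd (2 * a%:Z - 1) yz).1; move=> /(_ (ex_intro _ w wE)).
have /(rat_equation (2 * a%:Z - 1) 2 d%:Z y0 yz) : y%:Z * d%:Z =
    y%:Z * (2 * a%:Z - 1) ^+ 2 + 2 * 2 * x%:Z * (2 * a%:Z - 1) + 2 ^+ 2 * z.
  have -> : y%:Z * d%:Z = y%:Z * (2 * a%:Z - 1) ^+ 2 + 4 * (w * y%:Z).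
    by rewrite dE PoszD PoszM mE; ring.
  by rewrite wE; ring.
rewrite intrB intrM.
case: (r) qE => /= -> h dv; (split;
  first by apply/eqP; rewrite eqz_mod_dvd; apply: etrans dv; congr dvdz; ring).
- transitivity (d%:Z%:~R : rat) => //; by rewrite h intrN; ring.
- transitivity (d%:Z%:~R : rat) => //; by rewrite h; ring.
Qed.

(** Subtracting the equations of two elements of the same D(y, x) gives
    y | 2 (a - a') x, and x is invertible modulo y. *)
Lemma unit_param_sub (c : int) (r : residue) (y x a a' : nat) (m m' : int) :
  (0 < y)%N -> unit_param c r y x a m -> unit_param c r y x a' m' ->
  exists k w : int, [/\ 2 * (a%:Z - a'%:Z) = k * y%:Z,
    m - m' = (a%:Z - a'%:Z) * (a%:Z + a'%:Z - c) + w
    & w * y%:Z = 2 * (a%:Z - a'%:Z) * x%:Z].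
Proof.
move=> y0 [z [w [yz wE ->]]] [z' [w' [yz' wE' ->]]].
have y0' : y%:Z != 0 by lia.
have zz : z' = z by apply: (mulfI y0'); rewrite yz yz'.
rewrite {}zz in wE' yz'.
have ww : (w - w') * y%:Z = 2 * (a%:Z - a'%:Z) * x%:Z.
  by rewrite mulrBl wE wE'; ring.
have ss := residue_sign_sqr r; set s := residue_sign r in yz ss.
exists (s * ((w - w') * x%:Z - 2 * (a%:Z - a'%:Z) * z)), (w - w').
split=> //; last by ring.
transitivity (s * ((w - w') * y%:Z * x%:Z - 2 * (a%:Z - a'%:Z) * (y%:Z * z)));
  last by ring.
rewrite ww yz; transitivity (s * s * (2 * (a%:Z - a'%:Z))); last by ring.
by rewrite ss mul1r.
Qed.

(** The numbers 2 a and 2 a' are congruent modulo y, so they are equal when they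
    have the same quotient by y. *)
Lemma unit_param_inj (c : int) (r : residue) (y x a a' : nat) (m m' : int) :
  (0 < y)%N -> unit_param c r y x a m -> unit_param c r y x a' m' ->
  (2 * a %/ y = 2 * a' %/ y)%N -> m = m'.
Proof.
move=> y0 u u' aa; have [k [w [kE mE wE]]] := unit_param_sub y0 u u'.
have h1 := divn_eq (2 * a) y; have h2 := divn_eq (2 * a') y.
have := ltn_pmod (2 * a) y0; have := ltn_pmod (2 * a') y0.
move: h1 h2; rewrite aa; move: (_ %/ _)%N (_ %% _)%N (_ %% _)%N => q p p'.
move=> h1 h2 p1 p2.
have k0 : k = 0 by nia.
have aa' : a = a' by nia.
move: mE wE; rewrite aa' subrr mul0r add0r mulr0 mul0r => mE /eqP.
by rewrite mulf_eq0 => /orP[/eqP|]; lia.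
Qed.

(** For y > 2 the number x^2 cannot be both 1 and -1 modulo y. Both elements thus
    come from the same congruence, and the smaller one has the smaller parameter,
    so that y <= 2 (a - a'). *)
Lemma unit_param_gap (c : int) (r r' : residue) (y x a a' : nat) (m m' : int) :
  c = 0 \/ c = 1 -> (2 < y)%N -> (0 < a)%N -> (0 < a')%N ->
  unit_param c r y x a m -> unit_param c r' y x a' m' -> m' < m ->
  (y <= 2 * a)%N.
Proof.
move=> c01 y2 a0 a0' u u' mm.
have rr : r = r'.
  case: u u' => [z [w [yz _ _]]] [z' [w' [yz' _ _]]].
  have : y%:Z * (z - z') = residue_sign r' - residue_sign r.
    by rewrite mulrBr yz yz'; ring.
  have inj : residue_sign r = residue_sign r' -> r = r' by case: (r) (r') => -[].
  have : -2 <= residue_sign r' - residue_sign r <= 2 by case: (r) (r') => -[].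
  move=> + h; rewrite -h; move: (z - z') h => t h b; apply: inj.
  have [t0|t0] := ltP 0 t; first by nia.
  have [t1|t1] := ltP t 0; first by nia.
  have t2 : t = 0 by lia.
  by move: h; rewrite t2 mulr0; lia.
rewrite -rr in u'; have y0 : (0 < y)%N by lia.
have [k [w [kE mE wE]]] := unit_param_sub y0 u u'.
have [aa|aa] := ltnP a' a; first by have : 0 < k; nia.
exfalso; have h : w * y%:Z <= 0 by rewrite wE; nia.
have : w <= 0 by nia.
have : (a%:Z - a'%:Z) * (a%:Z + a'%:Z - c) <= 0 by nia.
lia.
Qed.

(** The constant 4 is attained for y = 1, c = 1, a = 2 and m = 1, that is d = 5. *)
Lemma unit_param_size (c : int) (r : residue) (y x a : nat) (m : int) :
  c = 0 \/ c = 1 -> (x < y)%N -> (0 < a)%N -> 0 < m ->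
  unit_param c r y x a m -> a%:Z ^+ 2 <= 4 * m.
Proof.
move=> c01 xy a0 m0 [z [w [yz wE mE]]].
case: (posnP x) => [x0|x0].
  have zs : y = 1%N /\ z = - residue_sign r.
    move: yz; rewrite x0 expr2 mul0r sub0r; clear -xy.
    have : y%:Z * z = 1 \/ y%:Z * z = -1 -> y = 1%N.
      move=> [] h; first by have [t0|t0] := ltP 0 z; nia.
      by have [t0|t0] := ltP z 0; nia.
    case: r => /= h1 h2.
      by have y1 := h1 (or_introl h2); split=> //; rewrite y1 in h2; lia.
    by have y1 := h1 (or_intror h2); split=> //; rewrite y1 in h2; lia.
  have ws : w = - residue_sign r.
    by case: zs wE => -> ->; rewrite x0 mulr0 add0r mulr1.
  move: mE m0; rewrite ws expr2; clear -c01 a0.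
  by case: c01 => ->; case: r => /=; nia.
have z0 : 0 <= y%:Z * z by rewrite yz expr2; case: (r) => /=; nia.
have z0' : 0 <= z by nia.
have w0 : 0 < w * y%:Z by rewrite wE; case: c01 => ->; nia.
have w0' : 0 < w by nia.
by rewrite mE expr2; case: c01 => ->; nia.
Qed.

(** * Discriminants that are not least *)

(** What the two cases of the theorem have in common: m ranges over the
    parameters of the discriminants val m, and alpha (val m) is the positive root
    of X^2 - c X - m. *)
Record discriminant_family (R : realType) (c : int)
    (Dc : residue -> nat -> nat -> set nat) (alpha : nat -> R)
    (val : nat -> nat) : Prop := DiscriminantFamily {
  family_c : c = 0 \/ c = 1;
  family_lt : forall m m', (val m' < val m)%N -> (m' < m)%N;
  family_val : forall r y x d, (0 < y)%N -> Dc r y x d -> exists m, d = val m;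
  family_D : forall r y x m, (0 < y)%N ->
    Dc r y x (val m) <-> [/\ (0 < m)%N, nonsquare (val m) &
      exists a : nat, (0 < a)%N /\ unit_param c r y x a m%:Z];
  family_order : forall m, (0 < m)%N -> nonsquare (val m) ->
    quadratic_order c m%:Z;
  family_root : forall m, (0 < m)%N -> nonsquare (val m) ->
    [/\ alpha (val m) ^+ 2 = c%:~R * alpha (val m) + m%:R,
       irrat (alpha (val m)) & 0 < alpha (val m)] }.

(** A discriminant belongs to the set D(y, x) of its minimal unit. For y > 2 it is
    not removed there, and if it is not the least element then a smaller one
    forces y to be at most twice the parameter a; for y <= 2 this is clear. *)
Lemma not_least_param (R : realType) (c : int) Dc (alpha : nat -> R) val m :
  discriminant_family c Dc alpha val -> (0 < m)%N -> nonsquare (val m) ->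
  ~ leasts Dc alpha (val m) ->
  exists r (y x a : nat), [/\ (x < y)%N, (0 < a)%N, (y <= 2 * a)%N
     & unit_param c r y x a m%:Z].
Proof.
move=> F m0 mn mL; have [e iu u0] := family_root F m0 mn.
have qo := family_order F m0 mn.
have [y [y0 [P yP] ymin]] := minimal_unit (m := m%:Z) e iu.
have [r [x [a [xy a0 ru]]]] := unit_param_exists qo y0 yP.
exists r, y, x, a; split=> //.
have [y2|y2] := leqP y 2; first by lia.
have Dm : D_all Dc y x (val m).
  by case: r ru => ru; [left|right]; apply/(family_D F) => //; split=> //; exists a.
have Dbar : D_bar Dc alpha y x (val m).
  split=> // -[_ [r' [n [/(family_D F _ _ _ y0)[_ _ [a' [a0' ru']]] sl]]]].
  rewrite ltnS leqNgt => /negP; apply.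
  by apply: (cf_period_gt (m := m%:Z) e iu u0 _ _ a0' ru' sl ymin); lia.
have [e' [[De' _] ltme]] : exists e', D_bar Dc alpha y x e' /\ (e' < val m)%N.
  apply: contrapT => h; apply: mL; exists y, x; split; last first.
    split=> // e' De'; rewrite leqNgt; apply/negP => lt; apply: h.
    by exists e'.
  split=> //; case: r ru => -[z [w [yz _ _]]]; [left|right];
    by apply/square_residueP; exists z.
have [r' Dr'] : exists r', Dc r' y x e'.
  by case: De' => De'; [exists MinusOne | exists PlusOne].
have [m' me'] := family_val F y0 Dr'; rewrite me' in Dr' ltme.
have [m0' mn' [a' [a0' ru']]] := (family_D F _ _ _ y0).1 Dr'.
apply: (unit_param_gap (family_c F) y2 a0 a0' ru ru').
by have := family_lt F ltme.
Qed.

Lemma nonsquare_sqr (d : nat) (p q : int) : nonsquare d -> q != 0 ->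
  p ^+ 2 != d%:Z * q ^+ 2.
Proof.
move=> dn q0; apply/eqP => /(congr1 absz).
rewrite abszM !abszX => h; apply: dn.
have : (`|q| ^ 2 %| `|p| ^ 2)%N by rewrite h dvdn_mull.
rewrite dvdn_pexp2r // => /dvdnP[k kE]; exists k.
move: h; rewrite kE expnMn /= => /eqP; rewrite eqn_pmul2r; last first.
  by rewrite expn_gt0 absz_gt0 q0.
by move=> /eqP.
Qed.

Lemma sqrt_family (R : realType) :
  discriminant_family 0 D0_case (@sqrt_nat R) id.
Proof.
split; [by left | by [] | by move=> r y x d _ _; exists d | exact: D0_caseP | |].
  move=> m m0 mn; split; [by left | by lia |] => P Q Q0.
  rewrite /qnorm mul0r mul0r subr0 subr_eq0; apply: nonsquare_sqr => //; lia.
move=> m m0 mn.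
have m0' : 0 < m%:R :> R by rewrite ltr0n.
split; [by rewrite /sqrt_nat sqr_sqrtr ?mul0r ?add0r // ltW | | by rewrite sqrtr_gt0].
move=> p q q0 h; have /eqP := nonsquare_sqr p mn q0; apply.
apply/eqP; rewrite -(eqr_int R) intrM !expr2 !intrM -h /sqrt_nat.
apply/eqP; transitivity (q%:~R ^+ 2 * (Num.sqrt m%:R) ^+ 2 : R); first by ring.
by rewrite sqr_sqrtr ?ltW //; ring.
Qed.

Lemma omega_family (R : realType) :
  discriminant_family 1 D1_case (@omega R) (fun m => 4 * m + 1)%N.
Proof.
split; [by right | by move=> m m'; lia | | | |].
- by move=> r y x d y0 /(D1_caseP _ _ _ y0)[_ _ [a [m [_ -> _]]]]; exists m.
- move=> r y x m y0; split.
    move=> /(D1_caseP _ _ _ y0)[_ mn [a [m' [a0 mm' u]]]].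
    have -> : m = m' by lia.
    have m0 : (0 < m)%N by case: (m) mn => //; case; exists 1%N.
    split=> //; [lia | by move: mn; rewrite mm' | by exists a].
  move=> [m0 mn [a [a0 u]]]; apply/(D1_caseP _ _ _ y0); split=> //; first by lia.
  by exists a, m.
- move=> m m0 mn; split; [by right | by lia |] => P Q Q0.
  have Q0' : Q != 0 by lia.
  apply/eqP => h; have /eqP := nonsquare_sqr (2 * P - Q) mn Q0'; apply.
  rewrite PoszD PoszM; apply/eqP; rewrite -subr_eq0; apply/eqP.
  by transitivity (4 * qnorm 1 m%:Z P Q); rewrite /qnorm; [ring | rewrite -/(qnorm 1 m%:Z P Q) h].
move=> m m0 mn.
have m0' : 0 < (4 * m + 1)%:R :> R by rewrite ltr0n addn1.
have -> : omega R (4 * m + 1) = (1 + Num.sqrt (4 * m + 1)%:R) / 2.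
  by rewrite /omega mulnC modnMDl eqxx.
have sE : Num.sqrt (4 * m + 1)%:R ^+ 2 = 4 * m%:R + 1 :> R.
  by rewrite sqr_sqrtr ?ltW // natrD natrM.
have s0 : 0 < Num.sqrt (4 * m + 1)%:R :> R by rewrite sqrtr_gt0.
move: (Num.sqrt _) sE s0 => s sE s0; split; last by apply: divr_gt0; lra.
  apply/eqP; rewrite -subr_eq0; apply/eqP.
  by transitivity ((s ^+ 2 - (4 * m%:R + 1)) / 4); [field | rewrite sE; ring].
move=> p q q0 h; have /eqP := nonsquare_sqr (2 * p - q) mn q0; apply.
apply/eqP; rewrite -(eqr_int R) PoszD PoszM !expr2 !(intrM, intrD, intrN) -h.
apply/eqP; transitivity (q%:~R ^+ 2 * s ^+ 2); first by field.
by rewrite sE; ring.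
Qed.

(** * Few square roots of 1 and -1 modulo y *)

Definition sqr_mod (r : residue) (y x : nat) : bool :=
  (y%:Z %| x%:Z ^+ 2 - residue_sign r)%Z.

(** Eliminating x between x^2 = e and (x + h)^2 = e modulo y shows that y divides
    h^2 (h^2 - 4 e). This number is less than (h + 1)^4 <= y in absolute value, so
    it is 0. *)
Lemma sqr_mod_gap (r : residue) (y x h m : nat) : (m ^ 4 <= y)%N ->
  (0 < h < m)%N -> sqr_mod r y x -> sqr_mod r y (x + h) -> h = 2.
Proof.
move=> my /andP[h0 hm] /dvdzP[u uE] /dvdzP[v vE].
have s1 : -1 <= residue_sign r <= 1 by case: (r).
move: (residue_sign r) s1 uE vE => s s1 uE vE.
pose k := h%:Z * (v - u) * (2 * x%:Z - h%:Z) - 4 * h%:Z ^+ 2 * u.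
have kE : k * y%:Z = - (h%:Z ^+ 2 * (h%:Z ^+ 2 - 4 * s)).
  transitivity (h%:Z * (v * y%:Z - u * y%:Z) * (2 * x%:Z - h%:Z)
                - 4 * h%:Z ^+ 2 * (u * y%:Z)); first by rewrite /k; ring.
  by rewrite -uE -vE PoszD; ring.
have h2 : 0 < h%:Z by [].
have yb : (h%:Z + 1) ^+ 4 <= y%:Z.
  have : ((h + 1) ^ 4 <= y)%N by apply: leq_trans my; rewrite leq_exp2r // addn1.
  lia.
have hb : h%:Z ^+ 2 * (h%:Z ^+ 2 + 4) < (h%:Z + 1) ^+ 4.
  rewrite -subr_gt0.
  have -> : (h%:Z + 1) ^+ 4 - h%:Z ^+ 2 * (h%:Z ^+ 2 + 4) =
    4 * h%:Z * (h%:Z * h%:Z) + 2 * h%:Z * h%:Z + 4 * h%:Z + 1 by ring.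
  by have := mulr_gt0 h2 (mulr_gt0 h2 h2); have := mulr_gt0 h2 h2; lia.
have h2' : 0 <= h%:Z ^+ 2 by rewrite sqr_ge0.
have lo : - y%:Z < k * y%:Z.
  rewrite kE ltrN2; apply: lt_le_trans yb; apply: le_lt_trans hb.
  by rewrite ler_wpM2l //; lia.
have hi : k * y%:Z < y%:Z.
  rewrite kE; apply: lt_le_trans yb; apply: le_lt_trans hb.
  by rewrite -mulrN ler_wpM2l //; lia.
have k0 : k = 0.
  have y0 : 0 < y%:Z by lia.
  have : -1 < k by rewrite -(ltr_pM2r y0); lia.
  have : k < 1 by rewrite -(ltr_pM2r y0); lia.
  by lia.
move: kE; rewrite k0 mul0r => /eqP; rewrite eq_sym oppr_eq0 mulf_eq0 sqrf_eq0.
case/orP=> [|/eqP]; first by lia.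
rewrite expr2 => E; nia.
Qed.

(** An interval of length n is covered by n / m + 1 windows of length m. *)
Lemma count_window (P : pred nat) (m : nat) : (0 < m)%N ->
  (forall a, (count P (iota a m) <= 2)%N) ->
  forall n a, (count P (iota a n) <= 2 * (n %/ m).+1)%N.
Proof.
move=> m0 Pm n; have [k] := ubnP n; elim: k n => // k IH n nk a.
have [nm|nm] := ltnP n m.
  rewrite divn_small //; apply: leq_trans (Pm a).
  by rewrite -(subnKC (ltnW nm)) iotaD count_cat leq_addr.
rewrite -(subnKC nm) iotaD count_cat divnDl // divnn m0 add1n.
have := IH (n - m)%N _ (a + m)%N; have := Pm a; lia.
Qed.

(** Among three solutions in a window of length m, two are at a distance other
    than 2. *)
Lemma count_sqr_mod (r : residue) (y m : nat) : (0 < m)%N -> (m ^ 4 <= y)%N ->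
  (count (sqr_mod r y) (iota 0 y) <= 2 * (y %/ m).+1)%N.
Proof.
move=> m0 my; apply: count_window => // a; rewrite leqNgt -size_filter.
apply/negP; set s := seq.filter _ _ => s2.
have ss : sorted ltn s.
  by apply: (sorted_filter ltn_trans); exact: iota_ltn_sorted.
have sP x : x \in s -> sqr_mod r y x /\ (a <= x < a + m)%N.
  by rewrite mem_filter mem_iota => /andP.
case: s s2 ss sP => [|x1 [|x2 [|x3 s]]] //= _ /and3P[x12 x23 _] sP.
have [p1 l1] := sP x1 (mem_head _ _).
have [p2 l2] : sqr_mod r y x2 /\ (a <= x2 < a + m)%N.
  by apply: sP; rewrite !inE eqxx orbT.
have [p3 l3] : sqr_mod r y x3 /\ (a <= x3 < a + m)%N.
  by apply: sP; rewrite !inE eqxx !orbT.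
have e12 : (x2 - x1)%N = 2.
  by apply: (sqr_mod_gap my _ p1); rewrite ?subnKC ?(ltnW x12) //; lia.
have e13 : (x3 - x1)%N = 2.
  by apply: (sqr_mod_gap my _ p1); rewrite ?subnKC //; lia.
lia.
Qed.

(** * Sums of positive families *)

Local Open Scope ereal_scope.

Lemma sub_esum (R : realType) (T : choiceType) (A B : set T) (a : T -> \bar R) :
  (forall t, B t -> 0 <= a t) -> (A `<=` B)%classic ->
  \esum_(t in A) a t <= \esum_(t in B) a t.
Proof.
move=> a0 AB; rewrite [leRHS](esumID A) // (setIidr AB) leeDl //.
by apply: esum_ge0 => t [/a0].
Qed.

Lemma esum_leD (R : realType) (T : choiceType) (A B C : set T)
    (a : T -> \bar R) : (forall t, B t -> 0 <= a t) ->
  (forall t, C t -> 0 <= a t) -> (A `<=` B `|` C)%classic ->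
  \esum_(t in A) a t <= \esum_(t in B) a t + \esum_(t in C) a t.
Proof.
move=> b0 c0 ABC; rewrite (esumID B) => [|t /ABC[/b0|/c0]//].
apply: leeD; apply: sub_esum => //.
by move=> t [/ABC[]].
Qed.

Lemma esum_nat_le (R : realType) (P : pred nat) (u : nat -> R) (M : \bar R) :
  (forall n, P n -> 0 <= u n)%R ->
  (forall N, (\sum_(0 <= n < N | P n) u n)%:E <= M) ->
  \esum_(n in [set n | P n]) (u n)%:E <= M.
Proof.
move=> u0 uM; rewrite -nneseries_esum => [|n Pn]; last by rewrite lee_fin u0.
apply: lime_le; last by apply: nearW => N; rewrite sumEFin.
by apply: is_cvg_nneseries_cond => n _ Pn; rewrite lee_fin u0.
Qed.

Lemma esumZl (R : realType) (P : pred nat) (c : R) (u : nat -> R) : (0 <= c)%R ->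
  (forall n, 0 <= u n)%R ->
  \esum_(n in [set n | P n]) (c * u n)%:E =
  c%:E * \esum_(n in [set n | P n]) (u n)%:E.
Proof.
move=> c0 u0; rewrite -!nneseries_esum => [|n _|n _]; rewrite ?lee_fin ?mulr_ge0 //.
by rewrite -nneseriesZl // => n _; rewrite lee_fin.
Qed.

Lemma esum_seq_const (R : realType) (T : choiceType) (s : seq T) (c : R) :
  uniq s -> (0 <= c)%R ->
  \esum_(t in [set` s]) c%:E = (c *+ size s)%:E.
Proof.
move=> us c0; rewrite esum_fset //.
rewrite -fsbig_seq // sumEFin; congr _%:E.
by rewrite big_const_seq count_predT iter_addr_0.
Qed.

(** * The zeta series *)

Definition pow_inv {R : realType} (s : R) (n : nat) : R := ((n%:R `^ s)^-1)%R.

Lemma pow_inv_ge0 (R : realType) (s : R) n : (0 <= pow_inv s n)%R.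
Proof. by rewrite invr_ge0 powR_ge0. Qed.

(** The bound (s - 1) n^-s <= (n - 1)^(1 - s) - n^(1 - s) makes the series
    telescope; it follows from 1 + x <= exp x and ln (1 + x) <= x. *)
Lemma pow_inv_telescope (R : realType) (s : R) n : (1 < s)%R -> (0 < n)%N ->
  ((s - 1) * pow_inv s n.+1 <= pow_inv (s - 1) n - pow_inv (s - 1) n.+1)%R.
Proof.
move=> s1 n0.
have n1 : (0 < n%:R :> R)%R by rewrite ltr0n.
have n2 : (0 < n.+1%:R :> R)%R by rewrite ltr0n.
pose t : R := (1 + - (n.+1%:R)^-1)%R.
have nE : n%:R = (n.+1%:R * t)%R :> R.
  by rewrite /t mulrDr mulr1 mulrN divff ?gt_eqF // -natr1; ring.
have t0 : (0 < t)%R by rewrite -(pmulr_rgt0 _ n2) -nE.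
have h1 : pow_inv (s - 1) n = (pow_inv (s - 1) n.+1 * (t `^ (s - 1))^-1)%R.
  by rewrite /pow_inv nE powRM ?ltW // invfM.
have h2 : (1 + (s - 1) * (n.+1%:R)^-1 <= (t `^ (s - 1))^-1)%R.
  rewrite -powRN /powR gt_eqF //; apply: le_trans (expR_ge1Dx _).
  rewrite lerD2l mulNr -mulrN ler_wpM2l //; first by lra.
  rewrite lerNr; apply: le_ln1Dx; rewrite ltrN2 invf_lt1 // ltr1n.
  by rewrite ltnS.
have h3 : pow_inv s n.+1 = (pow_inv (s - 1) n.+1 * (n.+1%:R)^-1)%R.
  rewrite /pow_inv -invfM; congr (_^-1)%R.
  by rewrite -[X in (_ * X)%R]powRr1 ?ltW // -powRD ?subrK //;
    apply/implyP => _; rewrite gt_eqF.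
have := pow_inv_ge0 (s - 1)%R n.+1.
rewrite h1 h3; move: (pow_inv _ _) (t `^ _)%R^-1%R h2 => p q h2 p0.
rewrite -subr_ge0.
have -> : (p * q - p - (s - 1) * (p * n.+1%:R^-1) =
  p * (q - (1 + (s - 1) * n.+1%:R^-1)))%R by ring.
by rewrite mulr_ge0 // subr_ge0.
Qed.

Lemma zeta_summable (R : realType) (s : R) : (1 < s)%R ->
  \esum_(n in [set n | (0 < n)%N]) (pow_inv s n)%:E < +oo.
Proof.
move=> s1; pose B : R := (1 + (s - 1)^-1)%R.
apply: (@le_lt_trans _ _ B%:E); last exact: ltry.
have s0 : (0 < s - 1)%R by rewrite subr_gt0.
apply: esum_nat_le => [n _|N]; first exact: pow_inv_ge0.
rewrite lee_fin.
suff H N' : (\sum_(0 <= n < N'.+2 | (0 < n)%N) pow_inv s n <=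
    1 + (1 - pow_inv (s - 1) N'.+1) / (s - 1))%R.
  apply: (@le_trans _ _ (\sum_(0 <= n < N.+2 | (0 < n)%N) pow_inv s n)%R).
    rewrite !(big_mkcond (fun n => (0 < n)%N)) /= !big_nat_recr //= -addrA lerDl.
    by apply: addr_ge0; [case: (0 < N)%N => // |]; exact: pow_inv_ge0.
  apply: le_trans (H N) _; rewrite lerD2l ler_pdivrMr // mulVf ?gt_eqF //.
  by rewrite gerBl pow_inv_ge0.
elim: N' => [|k IH].
  rewrite big_mkcond !big_nat_recr //= big_nil /pow_inv !powR1 !invr1.
  by rewrite subrr mul0r !addr0 add0r.
rewrite big_mkcond big_nat_recr //=; rewrite big_mkcond in IH.
apply: le_trans (lerD IH (lexx _)) _.
have := pow_inv_telescope s1 (ltn0Sn k); rewrite -ler_pdivlMl // => T.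
apply: le_trans (lerD (lexx _) T) _.
by rewrite le_eqVlt; apply/orP; left; apply/eqP; field; rewrite gt_eqF.
Qed.

(** * Discriminants with a small parameter have a convergent sum *)

(** The quartic root gained by the gaps between square roots modulo y makes the
    sum over y converge. *)
Lemma count_sqr_mod_weight (R : realType) (r : residue) (y : nat) : (0 < y)%N ->
  ((y%:R ^+ 2)^-1 *+ count (sqr_mod r y) (iota 0 y)
    <= 8 * pow_inv (5 / 4) y :> R)%R.
Proof.
move=> y0; have E : exists m, (m ^ 4 <= y)%N by exists 0%N.
have Eb m : (m ^ 4 <= y)%N -> (m <= y)%N.
  by move=> h; apply: leq_trans h; case: (m) => // k;
    rewrite -[X in (X <= _)%N]expn1 leq_pexp2l.
case: (ex_maxnP E Eb) => m my mmax.
have m0 : (0 < m)%N by apply: mmax; rewrite exp1n.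
have ym : (y < (m + 1) ^ 4)%N.
  by rewrite ltnNge; apply/negP => /mmax; rewrite addn1 ltnn.
have c := count_sqr_mod r m0 my.
have my' : (m <= y)%N by apply: Eb.
have cm : (count (sqr_mod r y) (iota 0 y) * m <= 4 * y)%N.
  have := leq_trunc_div y m; move: c; move: (count _ _) (y %/ m)%N => a b; nia.
have y0' : (0 < y%:R :> R)%R by rewrite ltr0n.
pose q : R := (y%:R `^ (1 / 4))%R.
have q0 : (0 < q)%R by apply: powR_gt0.
have q4 : (q ^+ 4 = y%:R)%R.
  rewrite -powR_mulrn ?ltW // -powRrM.
  have -> : (1 / 4 * 4 = 1 :> R)%R by field.
  by rewrite powRr1 // ltW.
have qm : (q <= 2 * m%:R)%R.
  apply: (@le_trans _ _ (m + 1)%:R).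
    have h : (q ^+ 4 <= (m + 1)%:R ^+ 4)%R by rewrite q4 -natrX ler_nat ltnW.
    by move: h; rewrite ler_pXn2r // nnegrE ?ler0n // ltW.
  have m1 : (1 <= m%:R :> R)%R by rewrite ler1n.
  by rewrite addn1 -natr1; lra.
have -> : pow_inv (5 / 4) y = (y%:R * q)^-1%R.
  rewrite /pow_inv; congr (_^-1)%R.
  have -> : (5 / 4 = 1 + 1 / 4 :> R)%R by field.
  rewrite powRD; last by apply/implyP => _; rewrite gt_eqF.
  by rewrite powRr1 // ltW.
have {}cm : ((count (sqr_mod r y) (iota 0 y))%:R * m%:R <= 4 * y%:R :> R)%R.
  by rewrite -!natrM ler_nat.
rewrite -[leLHS]mulr_natl; move: (count _ _) cm => a cm.
have am : (a%:R * q <= 8 * y%:R :> R)%R.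
  have a0 : (0 <= a%:R :> R)%R by rewrite ler0n.
  by have := ler_wpM2l a0 qm; lra.
rewrite -(ler_pM2r (mulr_gt0 (mulr_gt0 y0' y0') q0)).
have -> : (a%:R / y%:R ^+ 2 * (y%:R * y%:R * q) = a%:R * q :> R)%R.
  by field; rewrite gt_eqF.
have -> : (8 / (y%:R * q) * (y%:R * y%:R * q) = 8 * y%:R :> R)%R.
  by field; rewrite !gt_eqF.
by [].
Qed.

(** The discriminants with y <= 2 a, among which are all those that are not
    least. *)
Definition small_param (c : int) (r : residue) (val : nat -> nat) : set nat :=
  [set d | exists m y x a : nat, [/\ d = val m, (0 < m <= d)%N,
     [&& (x < y)%N, (0 < a)%N & (y <= 2 * a)%N] & unit_param c r y x a m%:Z]].

(** Triples (y, (x, k)), where k stands for the quotient of 2 a by y. *)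
Definition param_index (r : residue) : set (nat * (nat * nat)) :=
  ([set y | (0 < y)%N] `*`` (fun y => [set` seq.filter (sqr_mod r y) (iota 0 y)]
    `*`` (fun=> [set k | (0 < k)%N])))%classic.

Lemma param_index_summable (R : realType) (r : residue) :
  \esum_(t in param_index r) (16 / (t.1%:R ^+ 2) * pow_inv 2 t.2.2)%:E
    < +oo :> \bar R.
Proof.
pose u y : R := (16 / (y%:R ^+ 2))%R.
have u0 y : (0 <= u y)%R by rewrite divr_ge0 ?sqr_ge0.
rewrite -(esum_esum (a := fun y t => (u y * pow_inv 2 t.2)%:E)); last first.
  by move=> y t _ _; rewrite lee_fin mulr_ge0 ?pow_inv_ge0.
have [Z Zge ZE] : exists2 Z : R, (0 <= Z)%R &
    \esum_(k in [set k | (0 < k)%N]) (pow_inv 2 k)%:E = Z%:E.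
  have h : (1 < 2 :> R)%R by rewrite ltr1n.
  have := zeta_summable h.
  have : 0 <= \esum_(k in [set k | (0 < k)%N]) (pow_inv (2 : R) k)%:E.
    by apply: esum_ge0 => k _; rewrite lee_fin pow_inv_ge0.
  by case: (esum _ _) => // Z Z0 _; exists Z; rewrite // -lee_fin.
apply: (@le_lt_trans _ _ (\esum_(y in [set y | (0 < y)%N])
    (128 * Z * pow_inv (5 / 4) y)%:E)); last first.
  rewrite esumZl; [|by rewrite mulr_ge0|by move=> n; exact: pow_inv_ge0].
  have h : (1 < 5 / 4 :> R)%R by rewrite ltr_pdivlMr // mul1r ltr_nat.
  have := zeta_summable h.
  have : 0 <= \esum_(k in [set k | (0 < k)%N]) (pow_inv (5 / 4 : R) k)%:E.
    by apply: esum_ge0 => k _; rewrite lee_fin pow_inv_ge0.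
  by case: (esum _ _) => // v _ _; rewrite -EFinM ltry.
apply: le_esum => y y0.
rewrite -(esum_esum (a := fun _ k => (u y * pow_inv 2 k)%:E)); last first.
  by move=> *; rewrite lee_fin mulr_ge0 ?pow_inv_ge0.
rewrite (eq_esum (b := fun=> (u y * Z)%:E)) => [|x _]; last first.
  by rewrite /= esumZl ?u0 // ?ZE // => n; exact: pow_inv_ge0.
rewrite esum_seq_const ?filter_uniq ?iota_uniq ?mulr_ge0 // size_filter lee_fin.
have -> : (u y * Z *+ count (sqr_mod r y) (iota 0 y) =
    16 * Z * ((y%:R ^+ 2)^-1 *+ count (sqr_mod r y) (iota 0 y)))%R.
  by rewrite mulrnAr -[LHS]mulr_natr -[RHS]mulr_natr /u; ring.
have h : (0 <= 16 * Z)%R by rewrite mulr_ge0.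
apply: le_trans (ler_wpM2l h (count_sqr_mod_weight R r y0)) _.
by rewrite le_eqVlt; apply/orP; left; apply/eqP; ring.
Qed.

(** The index (y, (x, k)) of d determines it by unit_param_inj, and
    (k y)^2 <= (2 a)^2 <= 16 d by unit_param_size. *)
Lemma small_param_summable (R : realType) (c : int) (r : residue)
    (val : nat -> nat) : c = 0%R \/ c = 1%R ->
  \esum_(d in small_param c r val) (d%:R^-1)%:E < +oo :> \bar R.
Proof.
move=> c01; set A := small_param c r val.
pose Q (d : nat) (t : nat * (nat * nat)) := exists m a : nat,
  [/\ d = val m, (0 < m <= d)%N,
     [&& (t.2.1 < t.1)%N, (0 < a)%N & (t.1 <= 2 * a)%N],
     unit_param c r t.1 t.2.1 a m%:Z & t.2.2 = (2 * a %/ t.1)%N].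
have /choice[f fP] : forall d, exists t, A d -> Q d t.
  move=> d; have [[m [y [x [a [h1 h2 h3 h4]]]]]|nA] := pselect (A d).
    by exists (y, (x, 2 * a %/ y))%N => _; exists m, a.
  by exists (0, (0, 0))%N.
have finj : set_inj A f.
  move=> d d'; rewrite !inE => /fP[m [a [dE _ /and3P[xy _ _] u k]]].
  move=> /fP[m' [a' [dE' _ _ u' k']]] ff; rewrite -ff in u' k'.
  have y0 : (0 < (f d).1)%N by apply: leq_ltn_trans xy.
  have mm : m%:Z = m'%:Z by apply: (unit_param_inj y0 u u'); rewrite -k -k'.
  by rewrite dE dE'; case: mm => ->.
apply: le_lt_trans (param_index_summable R r).
pose W (t : nat * (nat * nat)) : \bar R :=
  (16 / (t.1%:R ^+ 2) * pow_inv 2 t.2.2)%:E.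
apply: (@le_trans _ _ (\esum_(d in A) W (f d))).
  apply: le_esum => d /fP[m [a [_ /andP[m0 md] /and3P[xy a0 ya] u k]]].
  have y0 : (0 < (f d).1)%N by apply: leq_ltn_trans xy.
  have am := unit_param_size (m := m%:Z) c01 xy a0 m0 u.
  have k0 : (0 < (f d).2.2)%N by rewrite k divn_gt0.
  have ky : ((f d).2.2 * (f d).1 <= 2 * a)%N by rewrite k leq_trunc_div.
  rewrite /W lee_fin; move: (f d).1 (f d).2.2 y0 k0 ky => y k' y0 k0 ky.
  have d0 : (0 < d%:R :> R)%R by rewrite ltr0n (leq_trans m0).
  have yr : (0 < y%:R :> R)%R by rewrite ltr0n.
  have kr : (0 < k'%:R :> R)%R by rewrite ltr0n.
  rewrite /pow_inv powR_mulrn ?ler0n //.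
  rewrite -(ler_pM2r (mulr_gt0 d0 (exprn_gt0 2 (mulr_gt0 kr yr)))).
  have -> : (d%:R^-1 * (d%:R * (k'%:R * y%:R) ^+ 2) = (k' * y)%:R ^+ 2 :> R)%R.
    by rewrite natrM; field; rewrite gt_eqF.
  have -> : (16 / y%:R ^+ 2 * (k'%:R ^+ 2)^-1 * (d%:R * (k'%:R * y%:R) ^+ 2) =
      16 * d%:R :> R)%R by field; rewrite !gt_eqF.
  rewrite -natrX -natrM ler_nat.
  have h : ((k' * y) ^ 2 <= (2 * a) ^ 2)%N by rewrite leq_exp2r.
  apply: leq_trans h _; rewrite expnMn; move: am; rewrite expr2 -mulnn; lia.
rewrite -(esum_image _ _ _ finj); apply: sub_esum.
  by move=> t _; rewrite lee_fin mulr_ge0 ?pow_inv_ge0 // divr_ge0 ?sqr_ge0.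
move=> _ [d /fP[m [a [_ _ /and3P[xy a0 ya] u k]]] <-].
have y0 : (0 < (f d).1)%N by apply: leq_ltn_trans xy.
split=> //; split; last by rewrite /= k divn_gt0.
rewrite /= mem_filter mem_iota; apply/andP; split; last by [].
by case: u => [z [w [yz _ _]]]; apply/dvdzP; exists z; rewrite -yz mulrC.
Qed.

(** * Comparison of the Dirichlet series *)

Lemma squares_summable (R : realType) :
  \esum_(d in [set (n ^ 2)%N | n in [set n | (0 < n)%N]]) (d%:R^-1)%:E
    < +oo :> \bar R.
Proof.
rewrite esum_image; last first.
  by move=> m n _ _ /eqP; rewrite eqn_exp2r // => /eqP.
have h : (1 < 2 :> R)%R by rewrite ltr1n.
apply: le_lt_trans (zeta_summable h); apply: le_esum => n _.
by rewrite /pow_inv powR_mulrn // natrX.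
Qed.

Lemma zetaE (R : realType) (s : R) :
  zeta s = dirichlet_sum [set d : nat | (0 < d)%N]%classic s.
Proof.
rewrite /dirichlet_sum -nneseries_esum => [|n _]; last first.
  by rewrite lee_fin pow_inv_ge0.
rewrite /zeta; congr (lim (_ @ \oo)%classic); apply/funext => N.
by rewrite (big_nat_widenl _ 0%N).
Qed.

(** For s > 1 both series converge and differ by the series over the missing
    discriminants, which is at most its value at s = 1. *)
Lemma dirichlet_sum_bounded_difference (R : realType) (A B E : set nat) :
  (A `<=` B)%classic -> (forall d, B d -> (0 < d)%N) ->
  (forall d, B d -> ~ A d -> E d) ->
  \esum_(d in E) (d%:R^-1)%:E < +oo :> \bar R ->
  bounded_difference (fun s : R => dirichlet_sum A s)
                     (fun s : R => dirichlet_sum B s).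
Proof.
move=> AB B0 BE Efin.
have inv0 d : 0 <= (d%:R^-1)%:E :> \bar R by rewrite lee_fin invr_ge0.
have pow0 (s : R) d : 0 <= (pow_inv s d)%:E by rewrite lee_fin pow_inv_ge0.
have [M ME] : exists M : R, \esum_(d in E) (d%:R^-1)%:E = M%:E.
  have : 0 <= \esum_(d in E) (d%:R^-1)%:E :> \bar R by exact: esum_ge0.
  by move: Efin; case: (esum _ _) => // v _ _; exists v.
exists M; near=> s.
have s1 : (1 < s)%R by near: s; exact: nbhs_right_gt.
have BD : dirichlet_sum B s =
    dirichlet_sum A s + \esum_(d in B `&` ~` A) (pow_inv s d)%:E.
  by rewrite /dirichlet_sum (esumID A) ?(setIidr AB).
have DM : \esum_(d in B `&` ~` A) (pow_inv s d)%:E <= M%:E.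
  rewrite -ME; apply: (@le_trans _ _ (\esum_(d in B `&` ~` A) (d%:R^-1)%:E)).
    apply: le_esum => d [/B0 d0 _]; rewrite lee_fin /pow_inv.
    have d1 : (1 <= d%:R :> R)%R by rewrite ler1n.
    rewrite lef_pV2 ?posrE ?powR_gt0 ?ltr0n //.
    by rewrite -[leLHS]powRr1 ?ler0n // ler_powR // ltW.
  by apply: sub_esum => // d [Bd nA]; exact: BE.
have Afin : dirichlet_sum A s < +oo.
  apply: le_lt_trans (zeta_summable s1); apply: sub_esum => // d /AB /B0; by [].
have A0 : 0 <= dirichlet_sum A s by apply: esum_ge0 => d _; exact: pow0.
have D0 : 0 <= \esum_(d in B `&` ~` A) (pow_inv s d)%:E by exact: esum_ge0.
move: BD Afin A0 D0 DM; case: (dirichlet_sum A s) => // a.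
case: (esum _ _) => // e -> _ a0; rewrite !lee_fin => e0 eM.
by rewrite opprD addrA subrr sub0r normrN ger0_norm.
Unshelve. all: by end_near. Qed.

Lemma not_least_small_param (R : realType) (c : int) Dc (alpha : nat -> R) val m :
  discriminant_family c Dc alpha val -> (m <= val m)%N -> (0 < m)%N ->
  nonsquare (val m) -> ~ leasts Dc alpha (val m) ->
  (small_param c MinusOne val `|` small_param c PlusOne val)%classic (val m).
Proof.
move=> F mm m0 mn mL; have [r [y [x [a [xy a0 ya u]]]]] := not_least_param F m0 mn mL.
have mm' : (0 < m <= val m)%N by rewrite m0.
by case: r u => u; [left|right]; exists m, y, x, a; split=> //; rewrite xy a0.
Qed.

Lemma small_param_setU_summable (R : realType) (c : int) val :
  c = 0%R \/ c = 1%R ->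
  \esum_(d in (small_param c MinusOne val `|` small_param c PlusOne val)%classic)
    (d%:R^-1)%:E < +oo :> \bar R.
Proof.
move=> c01.
apply: le_lt_trans (lte_add_pinfty (small_param_summable R MinusOne val c01)
  (small_param_summable R PlusOne val c01)).
by apply: esum_leD => // d _; rewrite lee_fin invr_ge0.
Qed.

Lemma leasts_case (R : realType) Dc (alpha : nat -> R) d : leasts Dc alpha d ->
  exists r y x, (0 < y)%N /\ Dc r y x d.
Proof.
move=> [y [x [[y0 _ _] [[[D|D] _] _]]]];
  by [exists MinusOne, y, x | exists PlusOne, y, x].
Qed.

Local Close Scope ereal_scope.
Local Close Scope ring_scope.

Theorem theorem4p2 (R : realType) :
  bounded_difference (fun s : R => dirichlet_sum (leasts0 R) s)
                     (fun s : R => zeta s) /\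
  bounded_difference (fun s : R => dirichlet_sum (leasts1 R) s)
                     (fun s : R => dirichlet_sum
                        [set d : nat | [/\ (1 <= d)%N, d = 1 %[mod 4] &
                                           nonsquare d]]%classic s).
Proof.
split.
  rewrite (_ : (fun s : R => zeta s) = dirichlet_sum [set d | 0 < d]%classic);
    last by apply/funext => s; exact: zetaE.
  have c01 : (0 = 0 :> int \/ 0 = 1 :> int)%R by left.
  pose squares := [set n ^ 2 | n in [set n | 0 < n]]%classic.
  apply: (@dirichlet_sum_bounded_difference _ _ _ (squares `|`
    (small_param 0 MinusOne id `|` small_param 0 PlusOne id))%classic); last first.
  - apply: le_lt_trans (lte_add_pinfty (squares_summable R)
      (small_param_setU_summable R id c01)).
    by apply: esum_leD => // d _; rewrite lee_fin invr_ge0.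
  - move=> d d0 dL; have [dn|dn] := pselect (nonsquare d).
      by right; apply: (not_least_small_param (sqrt_family R)).
    left; move/contrapT: dn d0 => [n ->]; rewrite /= expn_gt0 orbF => n0.
    by exists n.
  - by [].
  by move=> d /leasts_case[r [y [x [_ []]]]].
have c01 : (1 = 0 :> int \/ 1 = 1 :> int)%R by right.
apply: dirichlet_sum_bounded_difference; last first.
- exact: (small_param_setU_summable R (fun m => 4 * m + 1) c01).
- move=> d [d0 d1 dn] dL; have dE : d = 4 * (d %/ 4) + 1.
    by rewrite {1}(divn_eq d 4) d1 mulnC.
  rewrite dE; apply: (not_least_small_param (omega_family R)); rewrite -?dE //.
    by lia.
  by rewrite divn_gt0 // ltnNge; apply/negP => h; apply: dn; exists 1; lia.
- by move=> d [].
move=> d /leasts_case[r [y [x [y0 /(D1_caseP _ _ _ y0)[d0 dn [a [m [_ dE _]]]]]]]].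
by split=> //; rewrite dE mulnC modnMDl.
Qed.
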